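(* Let $d\ge2$, $k\ge1$ and $T=(1,2,\ldots,d-1,d^k,d-1,\ldots,2,1)$ ($d$ occurring $k$ times). Let $P=(p_1^{n_1},\ldots,p_t^{n_t})$ with $p_1>\cdots>p_t>0$ and all $n_i\ge1$ be a partition of diagonal lengths $T$. Then $P$ can occur as the Jordan type of a linear form for some graded complete intersection algebra quotient of $R=\mathsf k[x,y]$ of Hilbert function $T$ if and only if for each $i\in[2,t]$, $$p_{i-1}=n_{i-1}+n_i+p_i.$$
   Context: $\mathsf k$ is an infinite field of characteristic zero or of characteristic greater than $j:=2d+k-3$; $R=\mathsf k[x,y]$ with the standard grading. Here $T_i=i+1$ for $0\le i\le d-1$, $T_i=d$ for $d-1\le i\le d+k-2$, $T_i=j+1-i$ for $d+k-2\le i\le j$. The notation $p^{n}$ in a partition means the part $p$ repeated $n$ times. The diagonal lengths of a partition with parts $q_1\ge\cdots\ge q_s>0$ are $(t_0,t_1,\ldots)$ with $t_i=\#\{(r,c): 1\le r\le s,\ 1\le c\le q_r,\ r+c-2=i\}$. For a graded Artinian quotient $A=R/I$ and a nonzero linear form $\ell$, the Jordan type $P_{\ell,A}$ is the partition of Jordan block sizes of multiplication by $\ell$ on $A$. *)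

(* Defs.v *)
From HB Require Import structures.
From mathcomp Require Import all_boot all_order all_algebra all_field.
From mathcomp Require Export mpoly.

Set Implicit Arguments.
Unset Strict Implicit.
Unset Printing Implicit Defensive.

Import GRing.Theory.
Local Open Scope ring_scope.

Definition infinite_field (K : fieldType) : Prop :=
  forall s : seq K, exists x : K, x \notin s.

(* [pchar K] is empty in characteristic zero, and {p} in characteristic p. *)
Definition char_zero_or_gt (K : fieldType) (j : nat) : Prop :=
  forall p : nat, p \in [pchar K] -> (j < p)%N.

(* The sequence (1, 2, ..., d-1, d^k, d-1, ..., 2, 1), extended by 0 beyond the
   socle degree j = 2d+k-3 (the last subtraction is truncated). *)
Definition Tseq (d k i : nat) : nat :=
  let j := (2 * d + k - 3)%N in
  if (i <= d - 1)%N then i.+1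
  else if (i <= d + k - 2)%N then d
  else (j + 1 - i)%N.

(* The partition (p_1^{n_1}, ..., p_t^{n_t}), indices running from 1 to t. *)
Definition power_partition (t : nat) (p n : nat -> nat) : seq nat :=
  flatten [seq nseq (n i) (p i) | i <- iota 1 t].

(* Cells (r, c) of the Ferrers diagram are numbered from 0 here, so the
   condition r + c - 2 = i on 1-based coordinates reads r + c = i. *)
Definition diagonal_length (q : seq nat) (i : nat) : nat :=
  count (fun rc : nat * nat => (rc.1 + rc.2)%N == i)
    [seq (r, c) | r <- iota 0 (size q), c <- iota 0 (nth 0%N q r)].

(* q is the partition of Jordan block sizes of the nilpotent map f: there is a
   basis of V made of strings v, f v, ..., f^(m-1) v with f^m v = 0, one string
   for each part m of q. *)
Definition nilpotent_jordan_type (K : fieldType) (V : vectType K)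
    (f : V -> V) (q : seq nat) : Prop :=
  [/\ sorted geq q, 0%N \notin q &
    exists2 vs : seq V, size vs = size q &
      (forall r, (r < size q)%N -> iter (nth 0%N q r) f (nth 0 vs r) = 0) /\
      basis_of fullv (flatten [seq traject f mv.2 mv.1 | mv <- zip q vs])].

Section BinaryForms.

Variable K : fieldType.

Local Notation R := {mpoly K[2]}.

Definition ideal2 (f g : R) (p : R) : Prop :=
  exists u v : R, p = u * f + v * g.

Definition regular_sequence2 (f g : R) : Prop :=
  [/\ forall p : R, p * f = 0 -> p = 0,
      forall p : R, (exists u : R, p * g = u * f) -> exists u : R, p = u * f
    & ~ ideal2 f g 1].

(* A, which is finite dimensional over K, is presented by pi as the quotient of
   R by an ideal generated by a regular sequence of two homogeneous polynomials.
   An Artinian quotient of R has codimension two, hence two generators. *)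
Definition graded_CI_quotient (A : falgType K) (pi : {lrmorphism R -> A}) :
    Prop :=
  (forall a : A, exists p : R, pi p = a) /\
  exists f g : R,
    [/\ exists df : nat, f \is df.-homog,
        exists dg : nat, g \is dg.-homog,
        regular_sequence2 f g
      & forall p : R, pi p = 0 <-> ideal2 f g p].

(* The degree i component of the grading induced on A: the image of R_i, which
   is spanned by the monomials x^(i-b) y^b. *)
Definition graded_component (A : falgType K) (pi : {lrmorphism R -> A})
    (i : nat) : {vspace A} :=
  <<[seq pi ('X_ord0 ^+ (i - b) * 'X_ord_max ^+ b) | b <- iota 0 i.+1]%R>>%VS.

Definition hilbert_function (A : falgType K) (pi : {lrmorphism R -> A})
    (i : nat) : nat :=
  \dim (graded_component pi i).

Definition linear_form_jordan_type (A : falgType K) (pi : {lrmorphism R -> A})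
    (l : R) (q : seq nat) : Prop :=
  nilpotent_jordan_type (fun a : A => pi l * a) q.

End BinaryForms.

(* Main.v *)
(** Choose coordinates with [l = x]. A complete intersection ideal is generated
    by a form [F] monic in [y] and some [x^e G], with [G] monic in [y], of lower
    [y]-degree and prime to [F]. Dividing, [F = Q G + c x^s H], the ideal
    [(F, x^e G)] agrees below the [y]-degree of [G] with [(G, x^(e + s) H)],
    where [s = deg F - deg H], while the classes of [y^i G] for
    [deg G <= deg G + i < deg F] generate strings of length [e]. Iterating,
    Euclid's algorithm produces the blocks of the Jordan type of [x], with
    [n_i] the degrees of the quotients and
    [p_(i-1) - p_i = s = n_(i-1) + n_i]. Conversely, given such blocks, the forms
    [G_(i+1) = y^(n_i) G_i + x^(n_(i-1) + n_i) G_(i-1)], with [G_0 = 0] and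
    [G_1 = 1], yield the ideal [(G_(t+1), x^(p_t) G_t)]. *)

Require Import Defs.
From HB Require Import structures.
From mathcomp Require Import all_boot all_order all_algebra all_field.
From mathcomp Require Import mpoly.
From Stdlib Require Import IndefiniteDescription.
From mathcomp Require Import ring zify.

Set Implicit Arguments.
Unset Strict Implicit.
Unset Printing Implicit Defensive.

Import GRing.Theory.
Local Open Scope ring_scope.

(** * Homogenization and division by monic polynomials *)

Section Homogenization.

Variable K : fieldType.
Implicit Types (f g : {poly K}) (u v w : {poly {poly K}}).

(** With [x] set to 1, forms of degree [D] become polynomials in [y] of degree at most [D], so
    divisions take place in [{poly K}] and powers of [x] only record drops of degree. In
    [{poly {poly K}}] the outer indeterminate is [y] and the inner one is [x]. The algebra is then a
    module over [K[x]], and splitting it into cyclic summands [K[x]/(x^m)] gives a Jordan basis for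
    multiplication by [x]. The generators are forms of degrees 0, 1, 2, ..., taken in the order of
    nonincreasing parts: the cell in row [r] and column [c] of the Ferrers diagram carries an
    element of degree [r + c], which is why diagonal lengths give the Hilbert function.

    The forward direction meets two obstacles. A given Jordan basis bears no relation to the one
    produced by Euclid's algorithm, so Jordan types are compared through the ranks of powers. The
    blocks also come with their own indexing, so their relation is restated through multiplicities
    of parts in the partition alone. *)

Definition homogenize (D : nat) (f : {poly K}) : {poly {poly K}} :=
  \poly_(i < D.+1) (f`_i *: 'X^(D - i)).

Lemma coef_homogenize D f i :
  (homogenize D f)`_i = if (i <= D)%N then f`_i *: 'X^(D - i) else 0.
Proof. by rewrite coef_poly ltnS. Qed.

Lemma homogenizeD D f g :
  homogenize D (f + g) = homogenize D f + homogenize D g.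
Proof.
apply/polyP => i; rewrite coefD !coef_homogenize coefD.
by case: ifP => _; rewrite ?addr0 ?scalerDl.
Qed.

Lemma homogenize0 D : homogenize D 0 = 0.
Proof.
by apply/polyP => i; rewrite coef_homogenize !coef0 scale0r if_same.
Qed.

Lemma homogenizeZ D (a : K) f :
  homogenize D (a *: f) = a%:P *: homogenize D f.
Proof.
apply/polyP => i; rewrite coefZ !coef_homogenize coefZ.
by case: ifP => _; rewrite ?mulr0 // mul_polyC scalerA.
Qed.

Lemma homogenize_sum D (I : Type) (r : seq I) (F : I -> {poly K}) :
  homogenize D (\sum_(i <- r) F i) = \sum_(i <- r) homogenize D (F i).
Proof.
elim: r => [|i r IH]; first by rewrite !big_nil homogenize0.
by rewrite !big_cons homogenizeD IH.
Qed.

(** All terms of the coefficient of [y^i] carry the same power [x^(D + E - i)]; the size bounds make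
    every coefficient cut off by the truncation vanish. *)
Lemma homogenizeM D E f g : (size f <= D.+1)%N -> (size g <= E.+1)%N ->
  homogenize (D + E) (f * g) = homogenize D f * homogenize E g.
Proof.
move=> sf sg; apply/polyP => i.
rewrite coef_homogenize coefM coefM [RHS](eq_bigr
  (fun j : 'I_i.+1 => (f`_j * g`_(i - j)) *: 'X^(D + E - i))).
  case: leqP => [_|lt_i]; first by rewrite scaler_suml.
  rewrite big1 // => j _; have [ltD|leD] := ltnP D j.
    by rewrite nth_default ?mul0r ?scale0r // (leq_trans sf).
  by rewrite [g`__]nth_default ?mulr0 ?scale0r // (leq_trans sg) //; lia.
move=> [j /= lt_j] _; rewrite !coef_homogenize.
case: leqP => [leD|ltD]; last first.
  by rewrite mul0r [f`__]nth_default ?mul0r ?scale0r // (leq_trans sf).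
case: leqP => [leE|ltE]; last first.
  by rewrite mulr0 [g`__]nth_default ?mulr0 ?scale0r // (leq_trans sg).
rewrite -scalerAl -scalerAr scalerA -exprD; congr (_ *: 'X^_); lia.
Qed.

Lemma homogenize_shift D s f : (size f <= D.+1)%N ->
  homogenize (D + s) f = 'X^s *: homogenize D f.
Proof.
move=> sf; apply/polyP => i; rewrite coefZ !coef_homogenize.
case: (leqP i D) => [leD|ltD].
  rewrite (leq_trans leD) ?leq_addr // -scalerAr -exprD.
  by congr (_ *: 'X^_); lia.
by rewrite [f`__]nth_default ?scale0r ?mulr0 ?if_same // (leq_trans sf).
Qed.

Lemma size_homogenize D f : size f = D.+1 -> size (homogenize D f) = D.+1.
Proof.
move=> sf; rewrite size_poly_eq // subnn scaler_eq0 negb_or expr0 oner_eq0 andbT.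
have /= <- := congr1 predn sf.
by rewrite -/(lead_coef f) lead_coef_eq0 -size_poly_eq0 sf.
Qed.

Lemma homogenize_monic D f : f \is monic -> size f = D.+1 ->
  homogenize D f \is monic.
Proof.
move=> /monicP mf sf; apply/monicP.
rewrite lead_coefE size_homogenize // coef_homogenize leqnn subnn expr0 /=.
by rewrite -[D in f`_D]/(D.+1.-1) -sf -lead_coefE mf scale1r.
Qed.

Lemma homogenizeXn D i : (i <= D)%N ->
  homogenize D 'X^i = 'X^(D - i) *: 'X^i.
Proof.
move=> le_i; apply/polyP => m; rewrite coefZ coef_homogenize !coefXn.
have [->|] := eqVneq m i; first by rewrite le_i scale1r mulr1.
by rewrite scale0r mulr0 if_same.
Qed.

Lemma homogenizeE D f :
  homogenize D f = \sum_(i < D.+1) (f`_i *: 'X^(D - i)) *: 'X^i.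
Proof. by rewrite /homogenize poly_def. Qed.

Lemma homogenize1 : homogenize 0 1 = 1.
Proof. by have := homogenizeXn (leqnn 0); rewrite !expr0 scale1r. Qed.

End Homogenization.

(** Triangularity: subtracting a multiple of the top basis element cancels the leading coefficient.
    It serves over [K] for forms of a fixed degree and over [K[x]] for arbitrary elements. *)
Lemma monic_basis_expand (R : nzRingType) (B : nat -> {poly R}) (m : nat)
    (B_monic : forall b, (b < m)%N -> B b \is monic)
    (B_size : forall b, (b < m)%N -> size (B b) = b.+1) (u : {poly R}) :
  (size u <= m)%N -> exists c : nat -> R, u = \sum_(b < m) c b *: B b.
Proof.
elim: m B_monic B_size u => [|m IH] B_monic B_size u su.
  exists (fun=> 0); rewrite big_ord0.
  by apply/eqP; rewrite -size_poly_eq0 -leqn0.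
have su' : (size (u - u`_m *: B m)%R <= m)%N.
  apply/leq_sizeP => i; rewrite leq_eqVlt => /predU1P[<-|lt_i].
    have /monicP := B_monic m (leqnn _).
    by rewrite lead_coefE B_size //= coefB coefZ => ->; rewrite mulr1 subrr.
  rewrite coefB coefZ [u`_i]nth_default ?(leq_trans su) //.
  by rewrite [(B m)`_i]nth_default ?B_size // mulr0 subrr.
have [c Ec] := IH (fun b lt_b => B_monic b (leqW lt_b))
  (fun b lt_b => B_size b (leqW lt_b)) _ su'.
exists (fun b => if b == m then u`_m else c b).
rewrite big_ord_recr /= eqxx -[LHS](subrK (u`_m *: B m)) Ec; congr (_ + _).
by apply: eq_bigr => b _; rewrite ltn_eqF.
Qed.

(** Over [K[x]] only monic divisors are available, and uniqueness is what lets divisibility by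
    powers of [x] pass from an element to its quotient and remainder. *)
Lemma monic_division_unique (R : idomainType) (d q r q' r' : {poly R}) :
    d \is monic -> (size r < size d)%N -> (size r' < size d)%N ->
  q * d + r = q' * d + r' -> q = q' /\ r = r'.
Proof.
move=> md sr sr' eq_qr.
have Er: r = r'.
  have := congr1 (fun p => Pdiv.Ring.rmodp p d) eq_qr.
  by rewrite !Pdiv.RingMonic.rmodp_addl_mul_small.
split=> //; move: eq_qr; rewrite Er => /addIr /mulIf -> //.
exact: monic_neq0.
Qed.

(** * Strings of multiplication by x *)

Definition generated2 (L : comNzRingType) (f g p : L) : Prop :=
  exists u v : L, p = u * f + v * g.

Lemma generated2_lin (L : comNzRingType) (f g a b p q : L) :
  generated2 f g p -> generated2 f g q -> generated2 f g (a * p + b * q).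
Proof.
move=> [u [v ->]] [u' [v' ->]].
exists (a * u + b * u'), (a * v + b * v'); ring.
Qed.

Lemma generated2D (L : comNzRingType) (f g p q : L) :
  generated2 f g p -> generated2 f g q -> generated2 f g (p + q).
Proof. by move=> Ip Iq; have := generated2_lin 1 1 Ip Iq; rewrite !mul1r. Qed.

Lemma generated2Ml (L : comNzRingType) (f g a p : L) :
  generated2 f g p -> generated2 f g (a * p).
Proof. by move=> [u [v ->]]; exists (a * u), (a * v); ring. Qed.

Section AdaptedBasis.

Variable K : fieldType.
Implicit Types (F G H : {poly K}) (u v w : {poly {poly K}}).
Implicit Types (I J : {poly {poly K}} -> Prop) (P : seq nat).

(** The degree is exact, so that a monic polynomial yields a form monic in [y]. *)
Definition hform F : {poly {poly K}} := homogenize (size F).-1 F.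

Lemma hform_monic F : F \is monic -> hform F \is monic.
Proof.
move=> mF; apply: homogenize_monic => //.
by rewrite prednK // size_poly_gt0 monic_neq0.
Qed.

Lemma size_hform F : F \is monic -> size (hform F) = size F.
Proof.
move=> mF; rewrite size_homogenize prednK // ?size_poly_gt0 monic_neq0 //.
Qed.

Lemma hformM F G : F \is monic -> G \is monic ->
  hform (F * G) = hform F * hform G.
Proof.
move=> mF mG; rewrite /hform -homogenizeM ?leqSpred //; congr homogenize.
have := size_poly_gt0 F; have := size_poly_gt0 G.
rewrite !monic_neq0 // size_Mmonic ?monic_neq0 //; lia.
Qed.

Lemma hformXn n : hform 'X^n = 'X^n.
Proof. by rewrite /hform size_polyXn homogenizeXn // subnn expr0 scale1r. Qed.

(* When [I] is an ideal containing a form monic in ['X] of degree [size P], this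
   says that the [k[x]]-module [k[x,y]/I] is the direct sum of the modules
   [k[x]/(x^P_b)], generated by forms [hform (beta b)] of degree [b]. *)
Definition adapted I P : Prop :=
  exists beta : nat -> {poly K},
    (forall b, (b < size P)%N -> beta b \is monic /\ size (beta b) = b.+1) /\
    forall c : nat -> {poly K},
      I (\sum_(b < size P) c b *: hform (beta b)) <->
      (forall b, (b < size P)%N -> exists a, c b = 'X^(nth 0%N P b) * a).

Definition ci_ideal F G (e : nat) : {poly {poly K}} -> Prop :=
  generated2 (hform F) ('X^e *: hform G).

(* An element of degree in ['X] less than that of [F] is its own remainder
   modulo [F], and the remainder of a multiple of [x^e] is a multiple of
   [x^e]. *)
Lemma ci_ideal_reduced F G e u : F \is monic -> (size u < size F)%N ->
  ci_ideal F G e u ->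
  exists z q, u = 'X^e *: (z * hform G - q * hform F)
    /\ (size (z * hform G - q * hform F)%R < size F)%N.
Proof.
move=> mF su [a [z Eu]]; exists z.
have mFF := hform_monic mF.
exists (Pdiv.Ring.rdivp (z * hform G) (hform F)).
have := Pdiv.RingMonic.rdivp_eq mFF (z * hform G).
set q := Pdiv.Ring.rdivp _ _; set r := Pdiv.Ring.rmodp _ _ => Ez.
have -> : z * hform G - q * hform F = r by rewrite Ez addrC addKr.
have sr : (size r < size F)%N.
  rewrite -[in X in (_ < X)%N]size_hform //.
  by rewrite Pdiv.CommonRing.ltn_rmodpN0 // monic_neq0.
split=> //.
have [] := @monic_division_unique _ (hform F) 0 u
  (a + 'X^e *: q) ('X^e *: r) mFF _ _ _ => //.
- by rewrite size_hform.
- by rewrite size_hform // (leq_ltn_trans (size_scale_leq _ _)).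
- rewrite mul0r add0r Eu -scalerAr Ez scalerDr mulrDl -scalerAl addrA //.
Qed.

(** Small elements of the first ideal are [x^e (z G - q F)], and substituting for [F] gives
    [x^e ((z - q Q) G - c x^s q H)]. Conversely, in [x^(e + s) (z H - q G)] the factor [x^s H] is
    replaced by [c^-1 (F - Q G)]. *)
Lemma ci_ideal_link F G H Q e s (c : K) u :
    F \is monic -> G \is monic -> (size G < size F)%N -> c != 0 ->
    hform F = Q * hform G + (c%:P * 'X^s) *: hform H ->
    (size u < size G)%N ->
  ci_ideal F G e u <-> ci_ideal G H (e + s) u.
Proof.
move=> mF mG lt_GF c_neq0 EF su; split.
  case/(ci_ideal_reduced mF (ltn_trans su lt_GF)) => z [q [-> _]].
  exists ('X^e *: (z - q * Q)), (- c%:P *: q).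
  rewrite EF exprD -!mul_polyC !polyCM !polyCN; ring.
case/(ci_ideal_reduced mG su) => z [q [-> _]].
have EH : 'X^s *: hform H = (c^-1)%:P *: (hform F - Q * hform G).
  by rewrite EF [_ + _ *: _]addrC addrK scalerA mulrA -polyCM mulVf // mul1r.
exists ('X^e *: (z * (c^-1)%:P%:P)), (- z * (c^-1)%:P%:P * Q - 'X^s *: q).
rewrite exprD -scalerA scalerBr scalerAr EH -!mul_polyC; ring.
Qed.

(** Below the degree of [F], an element is uniquely [w G + v] with [v] of degree below that of [G],
    and it lies in the ideal exactly when [x^e] divides [w] and [v] lies in the ideal. The
    coefficients of [w] thus contribute summands [K[x]/(x^e)], while [v] is governed by [J]. *)
Lemma adapted_extend F G e J P :
    F \is monic -> G \is monic -> (size G <= size F)%N ->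
    size P = (size G).-1 -> adapted J P ->
    (forall u, (size u < size G)%N -> ci_ideal F G e u <-> J u) ->
  adapted (ci_ideal F G e) (P ++ nseq (size F - size G) e).
Proof.
move=> mF mG le_GF sP [beta [betaP PJ]] IJ.
set m' := size P in sP betaP PJ *; set n := (size F - size G)%N.
have sG : size G = m'.+1 by rewrite sP prednK // size_poly_gt0 monic_neq0.
pose beta' b := if (b < m')%N then beta b else 'X^(b - m') * G.
exists beta'; rewrite size_cat size_nseq -/m'.
have sizeXG i : size ('X^i * G) = (i + m').+1.
  by rewrite size_Mmonic ?monic_neq0 ?monicXn // size_polyXn sG addSn addnS.
split=> [b lt_b|c].
  rewrite /beta'; case: ltnP => [lt_bm|le_mb]; first exact: betaP.
  by rewrite monicMl ?monicXn // sizeXG subnK.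
pose v := \sum_(b < m') c b *: hform (beta b).
pose w : {poly {poly K}} := \poly_(b < n) c (m' + b)%N.
have -> : \sum_(b < m' + n) c b *: hform (beta' b) = w * hform G + v.
  rewrite big_split_ord /= addrC; congr (_ + _).
    rewrite /w poly_def mulr_suml; apply: eq_bigr => i _.
    rewrite /beta' ltnNge leq_addr /= addKn hformM ?monicXn //.
    by rewrite hformXn scalerAl.
  by apply: eq_bigr => b _; rewrite /beta' ltn_ord.
have sv : (size v < size G)%N.
  rewrite sG ltnS; apply: (leq_trans (size_sum _ _ _)); apply/bigmax_leqP => b _.
  rewrite (leq_trans (size_scale_leq _ _)) // size_hform;
    by case: (betaP b (ltn_ord b)) => // _ ->.
have nthP b : nth 0%N (P ++ nseq n e) b =
    if (b < m')%N then nth 0%N P b else if (b < m' + n)%N then e else 0%N.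
  rewrite nth_cat -/m'; case: ltnP => // le_mb.
  by rewrite nth_nseq ltn_subLR.
have IJv := IJ v sv.
split=> [Iwv|cP].
  have swv : (size (w * hform G + v)%R < size F)%N.
    rewrite (leq_ltn_trans (size_polyD _ _)) // gtn_max (leq_trans sv le_GF) andbT.
    have [->|nz_w] := eqVneq w 0.
      by rewrite mul0r size_poly0 size_poly_gt0 monic_neq0.
    rewrite size_Mmonic ?hform_monic // size_hform //.
    have := size_poly n (fun b => c (m' + b)%N); rewrite -/w => sw.
    apply: (@leq_ltn_trans (n + size G).-1); last by rewrite /n; lia.
    by rewrite -!subn1 leq_sub2r // leq_add2r.
  have [z [q [Ewv sr]]] := ci_ideal_reduced mF swv Iwv.
  set r := z * _ - _ in Ewv sr.
  have mGG := hform_monic mG.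
  have Er := Pdiv.RingMonic.rdivp_eq mGG r.
  set q2 := Pdiv.Ring.rdivp _ _ in Er; set r2 := Pdiv.Ring.rmodp _ _ in Er.
  (* Two divisions by [G] of the same element: [w G + v] and [x^e (q2 G + r2)]. *)
  have [] := @monic_division_unique _ (hform G) w v ('X^e *: q2) ('X^e *: r2) mGG.
  - by rewrite size_hform.
  - rewrite size_hform // (leq_ltn_trans (size_scale_leq _ _)) //.
    rewrite -[in X in (_ < X)%N]size_hform //.
    by rewrite Pdiv.CommonRing.ltn_rmodpN0 // monic_neq0.
  - by rewrite Ewv Er scalerDr scalerAl.
  move=> Ew Ev.
  have Iv : ci_ideal F G e v.
    have -> : v = 1 * (w * hform G + v) + (- q2) * ('X^e *: hform G).
      rewrite Ew -!mul_polyC; ring.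
    by apply: generated2_lin Iwv _; exists 0, 1; rewrite mul0r add0r mul1r.
  move=> b lt_b; rewrite nthP.
  case: ltnP => [lt_bm|le_mb]; first by apply: (PJ c).1 => //; apply/IJv.
  rewrite lt_b; exists q2`_(b - m').
  have := congr1 (fun p : {poly {poly K}} => p`_(b - m')) Ew.
  by rewrite coefZ coef_poly subnKC // ltn_subLR // lt_b.
have Iv : ci_ideal F G e v.
  apply/IJv/(PJ c).2 => b lt_b.
  by have := cP b (ltn_addr n lt_b); rewrite nthP lt_b.
have [w' Ew] : exists w', w = 'X^e *: w'.
  have [c' Ec'] : exists c' : nat -> {poly K},
      forall b, (b < n)%N -> c (m' + b)%N = 'X^e * c' b.
    have : forall b, exists a, (b < n)%N -> c (m' + b)%N = 'X^e * a.
      move=> b; case: (ltnP b n) => [lt_b|_]; last by exists 0.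
      have [|a Ea] := cP (m' + b)%N; first by rewrite ltn_add2l.
      by exists a; rewrite Ea nthP ltnNge leq_addr ltn_add2l lt_b.
    (* Finite choice of the quotients, by induction on their number. *)
    elim: n {w Iv IJv cP nthP} => [|n IH] cP; first by exists (fun=> 0).
    have [b|c' Ec'] := IH.
      by have [a Ea] := cP b; exists a => lt_b; rewrite Ea // ltnS ltnW.
    have [a Ea] := cP n.
    exists (fun b => if b == n then a else c' b) => b.
    rewrite ltnS leq_eqVlt; case: eqP => [->|_] //= lt_b; first exact: Ea.
    exact: Ec'.
  exists (\poly_(b < n) c' b); apply/polyP => b; rewrite coefZ !coef_poly.
  by case: ifP => [/Ec'|_] //; rewrite mulr0.
apply: generated2D => //.
by exists 0, w'; rewrite Ew mul0r add0r -!mul_polyC; ring.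
Qed.

(** Homogenizing the division in the degree of [F] pads [H] by [x^(deg F - deg H)], which is the
    gain in the exponent. *)
Lemma adapted_link F G H Q e (c : K) P :
    F \is monic -> G \is monic -> H \is monic ->
    (size G < size F)%N -> (size H < size G)%N -> c != 0 ->
    F = Q * G + c *: H -> size P = (size G).-1 ->
    adapted (ci_ideal G H (e + (size F - size H))) P ->
  adapted (ci_ideal F G e) (P ++ nseq (size F - size G) e).
Proof.
move=> mF mG mH lt_GF lt_HG c_neq0 EF sP adP.
apply: (adapted_extend mF mG (ltnW lt_GF) sP adP) => u su.
have sH : (0 < size H)%N by rewrite size_poly_gt0 monic_neq0.
apply: (@ci_ideal_link F G H (homogenize (size F - size G) Q)) => //;
  first exact: c_neq0.
rewrite -scalerA -homogenize_shift ?leqSpred //.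
have -> : ((size H).-1 + (size F - size H) = (size F).-1)%N by lia.
rewrite {1}/hform {2}EF homogenizeD homogenizeZ; congr (_ + _).
have -> : ((size F).-1 = (size F - size G) + (size G).-1)%N by lia.
rewrite homogenizeM ?leqSpred //.
(* The bound on [Q] holds because [Q G] has the degree of [F], the remainder being of lower
   degree. *)
have [->|nz_Q] := eqVneq Q 0; first by rewrite size_poly0.
have : size (Q * G) = (size Q + (size G).-1)%N.
  by rewrite size_Mmonic //; lia.
have -> : Q * G = F - c *: H by rewrite EF addrK.
rewrite size_polyDl; last by rewrite size_polyN size_scale // (ltn_trans lt_HG).
lia.
Qed.

(** The case [G = 1] of [adapted_extend]: the remainder [v] is zero, so [J] can be the ideal itself
    with an empty basis. *)
Lemma adapted_base F e : F \is monic ->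
  adapted (ci_ideal F 1 e) (nseq (size F).-1 e).
Proof.
move=> mF; have sF : (0 < size F)%N by rewrite size_poly_gt0 monic_neq0.
have := @adapted_extend F 1 e (ci_ideal F 1 e) [::] mF (monic1 _).
rewrite size_poly1 subn1; apply=> //.
exists (fun=> 1); split=> // c; split=> // _.
by rewrite big_ord0; exists 0, 0; rewrite !mul0r addr0.
Qed.

End AdaptedBasis.

(** * Euclidean chains and blocks *)

(** Strict decrease of [p] is a consequence of the last two clauses. *)
Definition ci_blocks (t : nat) (p n : nat -> nat) : Prop :=
  [/\ (0 < t)%N, forall i, (1 <= i <= t)%N -> (0 < p i)%N,
      forall i, (1 <= i <= t)%N -> (0 < n i)%N
    & forall i, (2 <= i <= t)%N -> p i.-1 = (n i.-1 + n i + p i)%N].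

Lemma power_partitionS t p n :
  power_partition t.+1 p n = power_partition t p n ++ nseq (n t.+1) (p t.+1).
Proof.
rewrite /power_partition (_ : iota 1 t.+1 = iota 1 t ++ [:: t.+1]).
  by rewrite map_cat flatten_cat /= cats0.
by have := iotaD 1 t 1; rewrite addn1 add1n.
Qed.

Lemma eq_power_partition t p n p' n' :
    (forall i, (1 <= i <= t)%N -> p i = p' i /\ n i = n' i) ->
  power_partition t p n = power_partition t p' n'.
Proof.
move=> eq_pn; congr flatten; apply/eq_in_map => i.
by rewrite mem_iota add1n ltnS => /eq_pn[-> ->].
Qed.

Section EuclideanChains.

Variable K : fieldType.
Implicit Types F G H : {poly K}.

(* Each division step [F = Q G + c H] links [(F, x^e G)] to [(G, x^e' H)] with
   [e' = e + deg F - deg H], and the degrees of the successive quotients are the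
   block sizes; this is the source of the relation between the blocks. *)
Lemma euclid_adapted F G e : F \is monic -> G \is monic ->
    (size G < size F)%N -> coprimep F G -> (0 < e)%N ->
  exists t p n, [/\ ci_blocks t p n, p t = e, n t = (size F - size G)%N,
    size (power_partition t p n) = (size F).-1
    & adapted (ci_ideal F G e) (power_partition t p n)].
Proof.
have [N] := ubnP (size G).
elim: N F G e => // N IH F G e ltN mF mG lt_GF coFG e_gt0.
have sG : (0 < size G)%N by rewrite size_poly_gt0 monic_neq0.
have [sG1|sG_neq1] := eqVneq (size G) 1%N.
  have G1 : G = 1.
    have [a _ Ea] := size_poly1P _ (introT eqP sG1).
    by move/monicP: mG; rewrite Ea lead_coefC => ->.
  exists 1%N, (fun=> e), (fun=> (size F).-1).
  rewrite /power_partition /= cats0 size_nseq sG1 subn1 G1.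
  split=> //; last exact: adapted_base.
  split=> //; last by move=> [|[|i]].
  by move=> i _; move: lt_GF; rewrite sG1; case: (size F) => [|[]].
set r : {poly K} := F %% G.
(* A zero remainder would make [G] a nonconstant common divisor. *)
have r_neq0 : r != 0.
  apply: contra sG_neq1 => /eqP r0.
  have : G %| F by rewrite /dvdp -/r r0.
  by move=> dvGF; rewrite size_poly_eq1 (coprimepP _ _ coFG G).
pose c := lead_coef r; have c_neq0 : c != 0 by rewrite lead_coef_eq0.
pose H : {poly K} := c^-1 *: r.
have sHr : size H = size r by rewrite size_scale // invr_eq0.
have mH : H \is monic by rewrite monicE lead_coefZ mulVf.
have lt_HG : (size H < size G)%N by rewrite sHr ltn_modp monic_neq0.
have EF : F = (F %/ G) * G + c *: H by rewrite scalerA mulfV // scale1r -divp_eq.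
have coGH : coprimep G H.
  by rewrite /H coprimepZr ?invr_eq0 // coprimep_modr coprimep_sym.
have [||t [p [n [[t_gt0 p_gt0 n_gt0 blocks] pt nt szP adP]]]] :=
  IH G H (e + (size F - size H))%N _ mG mH lt_HG coGH.
- by rewrite (leq_trans lt_HG).
- lia.
(* The pair [(G, H)] supplies the larger parts; the current division is the last block,
   [deg F - deg G] copies of [e]. *)
pose p' i := if i == t.+1 then e else p i.
pose n' i := if i == t.+1 then (size F - size G)%N else n i.
have EP : power_partition t.+1 p' n' =
    power_partition t p n ++ nseq (size F - size G) e.
  rewrite power_partitionS /p' /n' eqxx; congr (_ ++ _).
  by apply: eq_power_partition => i; case: eqP => //; lia.
exists t.+1, p', n'; rewrite EP /p' /n' eqxx; split=> //.
- split=> // i lt_i.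
  + by case: eqP => // ne_i; apply: p_gt0; lia.
  + by case: eqP => [_|ne_i]; [rewrite subn_gt0 | apply: n_gt0; lia].
  (* For the new index, [n t + n' t.+1] telescopes to [deg F - deg H], the gain in the exponent. *)
  + have [Ei|ne_i] := eqVneq i t.+1.
      by rewrite Ei succnK !ltn_eqF // pt nt; lia.
    by rewrite ltn_eqF ?blocks //; lia.
- by rewrite size_cat size_nseq szP; lia.
- exact: (adapted_link mF mG mH lt_GF lt_HG c_neq0 EF szP adP).
Qed.

(** At [x = 1] the recursion is that of continuants in powers of [y]. Euclid's algorithm undoes it
    one step at a time with quotient [y^(n_i)] and a monic remainder, and coprimality of consecutive
    terms is inherited. *)
Lemma continuant_adapted t p n : ci_blocks t p n ->
  exists F G, [/\ F \is monic, G \is monic, coprimep F G,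
    (size F = n t + size G)%N
    & size (power_partition t p n) = (size F).-1 /\
      adapted (ci_ideal F G (p t)) (power_partition t p n)].
Proof.
case=> t_gt0 _; case: t t_gt0 => // t _.
elim: t => [|t IH] n_gt0 blocks.
  exists 'X^(n 1%N), 1; rewrite monicXn monic1 coprimep1 size_polyXn size_poly1.
  rewrite addn1 power_partitionS /= size_nseq; split=> //; split=> //.
  by have := adapted_base (p 1%N) (monicXn K (n 1%N)); rewrite size_polyXn.
have [||F [G [mF mG coFG sF [szP adP]]]] := IH.
- by move=> i lt_i; apply: n_gt0; lia.
- by move=> i lt_i; apply: blocks; lia.
have nt1 : (0 < n t.+1)%N by apply: n_gt0; rewrite leqnSn.
have nt2 : (0 < n t.+2)%N by apply: n_gt0; rewrite leqnn.
have sG : (0 < size G)%N by rewrite size_poly_gt0 monic_neq0.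
have lt_GF : (size G < size F)%N by rewrite sF -add1n leq_add2r.
have sXF : size ('X^(n t.+2) * F) = (n t.+2 + size F)%N.
  by rewrite size_Mmonic ?monic_neq0 ?monicXn // size_polyXn.
pose F' := 'X^(n t.+2) * F + 1 *: G.
have lt_GXF : (size (1 *: G)%R < size ('X^(n t.+2) * F)%R)%N.
  by rewrite scale1r sXF (leq_trans lt_GF) ?leq_addl.
have sF' : size F' = (n t.+2 + size F)%N by rewrite size_polyDl.
have mF' : F' \is monic.
  by rewrite monicE lead_coefDl // lead_coef_Mmonic // lead_coefXn.
exists F', F; split=> //.
- by rewrite /F' scale1r coprimep_sym coprimep_addl_mul.
split; first by rewrite power_partitionS size_cat size_nseq szP sF'; lia.
have := @adapted_link K F' F G 'X^(n t.+2) (p t.+2) 1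
  (power_partition t.+1 p n) mF' mF mG.
rewrite sF' oner_eq0 szP addnK -power_partitionS => link.
(* The exponent required by the link is the preceding part, by the block relation and
   [deg F - deg G = n t.+1]. *)
have Ep : (p t.+2 + (n t.+2 + size F - size G) = p t.+1)%N.
  by rewrite (blocks t.+2 (leqnn _)) succnK sF; lia.
apply: link => //; last by rewrite Ep.
by rewrite -add1n leq_add2r.
Qed.

End EuclideanChains.

(** * Jordan types and block partitions *)

(** These truncated sums are the ranks of the powers of a nilpotent map. First differences count the
    parts exceeding [r], second differences the parts equal to [r + 1]. *)
Lemma sumn_sub_inj (q1 q2 : seq nat) :
    sorted geq q1 -> sorted geq q2 -> 0%N \notin q1 -> 0%N \notin q2 ->
    (forall r, \sum_(m <- q1) (m - r) = \sum_(m <- q2) (m - r))%N ->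
  q1 = q2.
Proof.
move=> s1 s2 nz1 nz2 eq_sum.
have sumS q r : (\sum_(m <- q) (m - r) =
    \sum_(m <- q) (m - r.+1) + count (fun m => r < m) q)%N.
  elim: q => [|m q IH]; first by rewrite !big_nil.
  by rewrite !big_cons IH /=; case: ltnP; lia.
have eq_gt r : count (fun m => r < m)%N q1 = count (fun m => r < m)%N q2.
  by have := eq_sum r; rewrite (sumS q1) (sumS q2) eq_sum => /addnI.
have countS q c : count (fun m => c < m)%N q =
    (count_mem c.+1 q + count (fun m => c.+1 < m)%N q)%N.
  by elim: q => //= m q ->; rewrite eqn_leq; case: ltngtP => //; lia.
apply: (@sorted_eq _ geq) => //.
- by move=> a b c /= le_ab le_ca; apply: leq_trans le_ab.
- by move=> a b /=; rewrite -eqn_leq => /eqP.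
apply/allP => c _ /=; case: c => [|c].
  by rewrite (count_memPn nz1) (count_memPn nz2).
by have := eq_gt c; rewrite (countS q1) (countS q2) eq_gt => /addIn ->.
Qed.

Lemma drop_traject (T : Type) (f : T -> T) x r n :
  drop r (traject f x n) = traject f (iter r f x) (n - r).
Proof.
elim: r n x => [|r IH] [|n] x; rewrite ?drop0 ?subn0 //.
by rewrite subSS /= IH -iterSr.
Qed.

Lemma trajectE (T : Type) (f : T -> T) x n :
  traject f x n = [seq iter i f x | i <- iota 0 n].
Proof.
elim: n x => //= n IH x; rewrite IH (iotaDl 1) -map_comp; congr (_ :: _).
by apply: eq_map => i /=; rewrite -iterSr.
Qed.

Section JordanTypeUniqueness.

Variables (K : fieldType) (V : vectType K) (f : {linear V -> V}).

Let pow r : 'End(V) := iter r (fun g => (linfun f \o g)%VF) \1%VF.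

Let powE r v : pow r v = iter r f v.
Proof. by elim: r => [|r IH] /=; rewrite ?id_lfunE // comp_lfunE lfunE IH. Qed.

(** The map [f^r] moves each string [r] places along and kills what passes its end, so the image has
    as basis the strings deprived of their first [r] vectors. *)
Let dim_pow q r : nilpotent_jordan_type f q ->
  \dim (pow r @: fullv) = (\sum_(m <- q) (m - r))%N.
Proof.
move=> [_ _ [vs szvs [kill basis_vs]]]; set ss := zip q vs in basis_vs.
have kill_ss mv : mv \in ss -> iter mv.1 f mv.2 = 0.
  case: mv => m v /(nthP (0%N, 0))[i lt_i].
  rewrite nth_zip //= => -[<- <-]; apply: kill.
  by move: lt_i; rewrite size_zip szvs minnn.
have -> : (\sum_(m <- q) (m - r) = \sum_(mv <- ss) (mv.1 - r))%N.
  by rewrite -(big_map fst xpredT (fun m => m - r)%N) -/unzip1 unzip1_zip ?szvs.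
pose B := flatten [seq drop r (traject f mv.2 mv.1) | mv <- ss].
have free_B : free B.
  (* The Jordan basis is rearranged with the heads of all strings before their tails, which form
     [B]. *)
  apply: (@catr_free _ _ (flatten [seq take r (traject f mv.2 mv.1) | mv <- ss])).
  have /(@perm_free K V) -> : perm_eq
      (flatten [seq take r (traject f mv.2 mv.1) | mv <- ss] ++ B)
      (flatten [seq traject f mv.2 mv.1 | mv <- ss]).
    rewrite /B; elim: (ss) => //= mv s IH.
    rewrite -[in X in perm_eq _ X](cat_take_drop r (traject f mv.2 mv.1)).
    by rewrite -!catA perm_cat2l perm_catCA perm_cat2l.
  exact: basis_free basis_vs.
have -> : (pow r @: fullv = <<B>>)%VS; last first.
  have /eqP -> := free_B; rewrite size_flatten /shape -map_comp sumnE big_map.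
  by apply: eq_bigr => mv _; rewrite /= size_drop size_traject.
rewrite -(span_basis basis_vs) limg_span; apply/eqP; rewrite eqEsubv.
apply/andP; split; apply/span_subvP => w.
  case/mapP => _ /flattenP[_ /mapP[mv mv_ss ->] /trajectP[i lt_i ->]] ->.
  rewrite powE -iterD; have [lt_ri|le_ri] := ltnP (r + i) mv.1.
    apply/memv_span/flattenP; exists (drop r (traject f mv.2 mv.1)).
      exact: map_f.
    rewrite drop_traject; apply/trajectP.
    by exists i; rewrite -?iterD 1?addnC //; lia.
  rewrite -(subnK le_ri) iterD kill_ss //.
  by rewrite -powE linear0 mem0v.
case/flattenP => _ /mapP[mv mv_ss ->]; rewrite drop_traject => /trajectP[i lt_i ->].
rewrite -iterD addnC iterD -powE; apply/memv_span/map_f/flattenP.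
exists (traject f mv.2 mv.1); first exact: map_f.
apply/trajectP; exists i => //.
by move: lt_i; rewrite ltn_subRL; apply: leq_ltn_trans (leq_addl _ _).
Qed.

Lemma nilpotent_jordan_type_uniq q1 q2 :
  nilpotent_jordan_type f q1 -> nilpotent_jordan_type f q2 -> q1 = q2.
Proof.
move=> J1 J2; have [s1 nz1 _] := J1; have [s2 nz2 _] := J2.
by apply: sumn_sub_inj => // r; rewrite -!dim_pow.
Qed.

End JordanTypeUniqueness.

(** * Partitions written with multiplicities *)

Section PowerPartition.

Implicit Types (t : nat) (p n : nat -> nat).

Definition decreasing_upto t p : Prop :=
  forall i j, (1 <= i)%N -> (i < j)%N -> (j <= t)%N -> (p j < p i)%N.

Lemma decreasing_uptoS t p :
  (forall i, (1 <= i < t)%N -> (p i.+1 < p i)%N) -> decreasing_upto t p.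
Proof.
move=> p_decr i j i_gt0; elim: j => // j IH.
rewrite ltnS leq_eqVlt => /predU1P[<-|lt_ij] lt_jt; first exact/p_decr/andP.
by apply: ltn_trans (IH lt_ij (ltnW lt_jt)); apply: p_decr; lia.
Qed.

Lemma mem_power_partition t p n x :
    (forall i, (1 <= i <= t)%N -> (0 < n i)%N) ->
  reflect (exists2 i, (1 <= i <= t)%N & x = p i) (x \in power_partition t p n).
Proof.
move=> n_gt0; apply: (iffP flattenP) => [[_ /mapP[i i_t ->]]|[i i_t ->]].
  by rewrite mem_nseq => /andP[_ /eqP->]; exists i; rewrite ?mem_iota ?ltnS in i_t *.
exists (nseq (n i) (p i)); last by rewrite mem_nseq n_gt0 ?eqxx.
by apply/mapP; exists i; rewrite // mem_iota add1n ltnS.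
Qed.

Lemma power_partition_gt0 t p n :
    (forall i, (1 <= i <= t)%N -> (0 < n i)%N) ->
    (forall i, (1 <= i <= t)%N -> (0 < p i)%N) ->
  0%N \notin power_partition t p n.
Proof.
move=> n_gt0 p_gt0; apply/negP => /(mem_power_partition p _ n_gt0)[i /p_gt0].
by move=> + E0; rewrite -E0.
Qed.

Lemma count_power_partition t p n i :
    decreasing_upto t p -> (1 <= i <= t)%N ->
  count_mem (p i) (power_partition t p n) = n i.
Proof.
elim: t => [|t IH] p_decr; first by case: i.
move=> /andP[i_gt0]; rewrite power_partitionS count_cat count_nseq /=.
rewrite leq_eqVlt => /predU1P[->|lt_it].
  have /count_memPn -> : p t.+1 \notin power_partition t p n; last first.
    by rewrite eqxx mul1n.
  apply/negP => /flattenP[_ /mapP[j j_t ->]].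
  rewrite mem_nseq mem_iota in j_t * => /andP[_ /eqP Ep].
  have : (p t.+1 < p j)%N by apply: p_decr; lia.
  by rewrite Ep ltnn.
rewrite IH ?i_gt0 // => [|j k j_gt0 lt_jk le_kt]; last exact: p_decr (leqW _).
by rewrite ltn_eqF ?addn0 // p_decr.
Qed.

(** The relation between adjacent distinct parts, free of indices, so that it passes between two
    descriptions [(t, p, n)] of one partition. *)
Definition block_relation (P : seq nat) : Prop :=
  forall u v, u \in P -> v \in P -> (v < u)%N ->
    (forall w, w \in P -> ~ (v < w < u)%N) ->
  u = (count_mem u P + count_mem v P + v)%N.

(** Strict decrease makes [count_mem (p i)] equal to [n i] and identifies adjacent values with
    adjacent indices. *)
Lemma block_relationP t p n :
    decreasing_upto t p -> (forall i, (1 <= i <= t)%N -> (0 < n i)%N) ->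
  block_relation (power_partition t p n) <->
  (forall i, (2 <= i <= t)%N -> p i.-1 = (n i.-1 + n i + p i)%N).
Proof.
move=> p_decr n_gt0; have memP := mem_power_partition p _ n_gt0.
split=> [rel i lt_i|blocks u v /memP[i i_t ->] /memP[j j_t ->] lt_ji nobetween].
  rewrite -[n i.-1](@count_power_partition t p n) //; last by lia.
  rewrite -[n i](@count_power_partition t p n) //; last by lia.
  apply: rel.
  - by apply/memP; exists i.-1 => //; lia.
  - by apply/memP; exists i => //; lia.
  - by apply: p_decr; lia.
  move=> w /memP[k k_t ->] /andP[lt_ik lt_ki].
  have [le_ki|lt_ik'] := leqP k i.-1.
    have [Ek|ne_k] := eqVneq k i.-1; first by rewrite Ek ltnn in lt_ki.
    have : (p i.-1 < p k)%N by apply: p_decr; lia.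
    lia.
  have [Ek|ne_k] := eqVneq k i; first by rewrite Ek ltnn in lt_ik.
  have : (p k < p i)%N by apply: p_decr; lia.
  lia.
rewrite !count_power_partition //.
have [lt_ij|gt_ij|Eij] := ltngtP i j; last by rewrite Eij ltnn in lt_ji.
  have [Ej|ne_j] := eqVneq j i.+1; first by rewrite Ej (blocks i.+1) //; lia.
  case: (nobetween (p i.+1)); first by apply/memP; exists i.+1 => //; lia.
  by apply/andP; split; apply: p_decr; lia.
have : (p i < p j)%N by apply: p_decr; lia.
lia.
Qed.

Lemma ci_blocks_decreasing t p n : ci_blocks t p n -> decreasing_upto t p.
Proof.
move=> [t_gt0 p_gt0 n_gt0 blocks]; apply: decreasing_uptoS => i lt_i.
have := blocks i.+1; have := n_gt0 i; have := n_gt0 i.+1; rewrite /=; lia.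
Qed.

Lemma sorted_power_partition t p n :
    decreasing_upto t p -> sorted geq (power_partition t p n).
Proof.
elim: t => // t IH p_decr; rewrite power_partitionS.
have geq_tr : transitive geq by move=> a b c /= ab ca; apply: leq_trans ab.
rewrite sorted_pairwise // pairwise_cat -!sorted_pairwise // IH /=; last first.
  by move=> i j i_gt0 lt_ij le_jt; apply: p_decr => //; apply: leqW.
apply/andP; split; last first.
  by elim: (n t.+1) => // -[|k] //= IHk; rewrite leqnn.
apply/allrelP => u v /flattenP[_ /mapP[j j_t ->]].
rewrite !mem_nseq mem_iota in j_t * => /andP[_ /eqP->] /andP[_ /eqP->] /=.
by apply/ltnW/p_decr; lia.
Qed.

End PowerPartition.

(** * Bases indexed by the cells of a partition *)

Section AdaptedCells.

Variable K : fieldType.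
Implicit Types (u v : {poly {poly K}}) (a : pred (nat * nat)).

(** The list of cells that [diagonal_length] counts. *)
Definition cells (P : seq nat) : seq (nat * nat) :=
  [seq (r, c) | r <- iota 0 (size P), c <- iota 0 (nth 0%N P r)].

Lemma mem_cells P rc :
  (rc \in cells P) = (rc.1 < size P)%N && (rc.2 < nth 0%N P rc.1)%N.
Proof.
case: rc => r c; apply/allpairsPdep/andP => [[r' [c' []]]|[lt_r lt_c]].
  by rewrite !mem_iota => lt_r lt_c [-> ->].
by exists r, c; rewrite !mem_iota.
Qed.

Lemma uniq_cells P : uniq (cells P).
Proof.
by apply: allpairs_uniq_dep => [|r _|[r c] [r' c'] _ _ [-> ->]] //; rewrite iota_uniq.
Qed.

Lemma big_cells P (V : nmodType) (E : nat * nat -> V) :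
  \sum_(rc <- cells P) E rc =
  \sum_(r < size P) \sum_(c < nth 0%N P r) E (r : nat, c : nat).
Proof.
have iotaE n (G : nat -> V) : \sum_(i <- iota 0 n) G i = \sum_(i < n) G i.
  by rewrite -(big_mkord xpredT) /index_iota subn0.
by rewrite /cells big_allpairs_dep iotaE; apply: eq_bigr => r _; rewrite iotaE.
Qed.

Variables (f g : {poly {poly K}}) (P : seq nat) (F : {poly K}).
Variable beta : nat -> {poly K}.

Local Notation I := (generated2 f g).

Hypothesis F_monic : F \is monic.
Hypothesis size_F : size F = (size P).+1.
Hypothesis IF : I (hform F).
Hypothesis betaP :
  forall b, (b < size P)%N -> beta b \is monic /\ size (beta b) = b.+1.
Hypothesis adapted_beta : forall c : nat -> {poly K},
  I (\sum_(b < size P) c b *: hform (beta b)) <->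
  (forall b, (b < size P)%N -> exists w, c b = 'X^(nth 0%N P b) * w).

(** A form of degree [r + c], since [beta r] has degree [r]: a diagonal of the diagram lies in a
    single degree. *)
Definition cell_form (rc : nat * nat) : {poly {poly K}} :=
  'X^(rc.2) *: hform (beta rc.1).

(** Gathered along row [r], the coefficients form a polynomial in [x] of degree less than [P_r] that
    is divisible by [x^(P_r)]. *)
Lemma cells_independent (v : nat * nat -> K) :
    I (\sum_(rc <- cells P) (v rc)%:P *: cell_form rc) ->
  forall rc, rc \in cells P -> v rc = 0.
Proof.
pose c r := \poly_(i < nth 0%N P r) v (r, i).
rewrite big_cells (eq_bigr (fun r : 'I_(size P) => c r *: hform (beta r))).
  move=> /adapted_beta cP [r i]; rewrite mem_cells => /andP[/= lt_r lt_i].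
  have [w Ew] := cP r lt_r; have := congr1 (fun q : {poly K} => q`_i) Ew.
  by rewrite coef_poly lt_i coefXnM lt_i.
move=> r _; rewrite /c poly_def scaler_suml; apply: eq_bigr => i _.
by rewrite /cell_form scalerA mul_polyC.
Qed.

(** The predicate [a] selects one diagonal for the Hilbert function and all cells for the Jordan
    basis. *)
Definition spanned_mod a u : Prop :=
  exists v : nat * nat -> K,
    I (u - \sum_(rc <- cells P | a rc) (v rc)%:P *: cell_form rc).

Lemma spanned_modD a u u' :
  spanned_mod a u -> spanned_mod a u' -> spanned_mod a (u + u').
Proof.
move=> [v Iv] [v' Iv']; exists (fun rc => v rc + v' rc).
have := generated2D Iv Iv'; congr I; rewrite addrACA -opprD -big_split /=.
congr (_ - _); apply: eq_bigr => rc _.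
by rewrite polyCD scalerDl.
Qed.

Lemma spanned_modZ a (x : K) u : spanned_mod a u -> spanned_mod a (x%:P *: u).
Proof.
move=> [v Iv]; exists (fun rc => x * v rc).
have := generated2Ml x%:P%:P Iv; congr I; rewrite mul_polyC scalerBr scaler_sumr.
congr (_ - _); apply: eq_bigr => rc _.
by rewrite scalerA polyCM.
Qed.

Lemma spanned_mod_ideal a u : I u -> spanned_mod a u.
Proof.
move=> Iu; exists (fun=> 0); rewrite big1 ?subr0 // => rc _.
by rewrite polyC0 scale0r.
Qed.

Lemma spanned_mod_sum a (J : Type) (r : seq J) (E : J -> {poly {poly K}}) :
  (forall j, spanned_mod a (E j)) -> spanned_mod a (\sum_(j <- r) E j).
Proof.
move=> spE; elim: r => [|j r IH]; last by rewrite big_cons; apply: spanned_modD.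
by rewrite big_nil; apply: spanned_mod_ideal; exists 0, 0; rewrite !mul0r addr0.
Qed.

(** A position beyond the end of its row gives an element of the ideal, so the column needs no
    bound. *)
Lemma spanned_mod_cell a rc : (rc.1 < size P)%N -> a rc ->
  spanned_mod a (cell_form rc).
Proof.
case: rc => b i /= lt_b abi; have [lt_i|le_i] := ltnP i (nth 0%N P b).
  exists (fun rc => (rc == (b, i))%:R).
  rewrite -big_filter (bigD1_seq (b, i)) /=; last 2 first.
  - by rewrite mem_filter abi mem_cells lt_b.
  - by rewrite filter_uniq ?uniq_cells.
  rewrite eqxx scale1r big1 ?addr0 ?subrr; last first.
    by move=> rc /negPf ->; rewrite polyC0 scale0r.
  by exists 0, 0; rewrite !mul0r addr0.
apply: spanned_mod_ideal; rewrite /cell_form /=.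
pose c r : {poly K} := if r == b then 'X^i else 0.
have -> : 'X^i *: hform (beta b) = \sum_(r < size P) c r *: hform (beta r).
  rewrite (bigD1 (Ordinal lt_b)) //= /c eqxx big1 ?addr0 // => r ne_rb.
  by rewrite ifN ?scale0r.
apply/adapted_beta => r lt_r; rewrite /c; case: eqP => [->|_].
  by exists 'X^(i - nth 0%N P b); rewrite -exprD subnKC.
by exists 0; rewrite mulr0.
Qed.

Lemma spanned_mod_form D (h : {poly K}) : (size h <= D.+1)%N ->
  spanned_mod (fun rc => (rc.1 + rc.2)%N == D) (homogenize D h).
Proof.
(* From degree [size P] on, the basis is continued by [y^i F], whose homogenization lies in the
   ideal. *)
move=> sh; pose beta' b := if (b < size P)%N then beta b else 'X^(b - size P) * F.
have mbeta' b : beta' b \is monic.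
  by rewrite /beta'; case: ltnP => [/betaP[]|_] //; rewrite monicMl ?monicXn.
have sbeta' b : size (beta' b) = b.+1.
  rewrite /beta'; case: ltnP => [/betaP[]//|le_b].
  rewrite size_Mmonic ?monic_neq0 ?monicXn // size_polyXn size_F.
  by rewrite addnS /= addSn subnK.
have [c ->] := monic_basis_expand (fun b _ => mbeta' b) (fun b _ => sbeta' b) sh.
rewrite homogenize_sum; apply: spanned_mod_sum => -[b lt_b] /=.
rewrite homogenizeZ; apply: spanned_modZ.
have -> : homogenize D (beta' b) = 'X^(D - b) *: hform (beta' b).
  by rewrite /hform sbeta' /= -homogenize_shift ?sbeta' // subnKC.
rewrite /beta'; case: ltnP => [lt_bm|le_b].
  by apply: (@spanned_mod_cell _ (b, D - b)%N) => //=; rewrite subnKC.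
apply: spanned_mod_ideal; rewrite hformM ?monicXn // -mul_polyC mulrA.
exact: generated2Ml.
Qed.

Lemma spanned_mod_all u : spanned_mod xpredT u.
Proof.
have mFF := hform_monic F_monic.
rewrite (Pdiv.RingMonic.rdivp_eq mFF u); apply: spanned_modD.
  exact/spanned_mod_ideal/generated2Ml.
set r := Pdiv.Ring.rmodp _ _.
have sr : (size r <= size P)%N.
  by rewrite -ltnS -size_F -size_hform // Pdiv.CommonRing.ltn_rmodpN0 // monic_neq0.
have [||c ->] := @monic_basis_expand _ (fun b => hform (beta b)) _ _ _ r sr.
- by move=> b /betaP[mb _]; apply: hform_monic.
- by move=> b /betaP[mb sb]; rewrite size_hform.
apply: spanned_mod_sum => -[b lt_b] /=.
rewrite -[c b]coefK poly_def scaler_suml; apply: spanned_mod_sum => i.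
rewrite -mul_polyC -scalerA; apply: spanned_modZ.
exact: (@spanned_mod_cell _ (b, i : nat)).
Qed.

(** * Jordan type and Hilbert function of the quotient *)

Section Quotient.

Variables (A : falgType K) (rho : {rmorphism {poly {poly K}} -> A}).
Hypothesis rhoC : forall x : K, rho x%:P%:P = x%:A.
Hypothesis rho_surj : forall y : A, exists u, rho u = y.
Hypothesis ker_rho : forall u, rho u = 0 <-> I u.

Lemma rhoZ (x : K) u : rho (x%:P *: u) = x *: rho u.
Proof. by rewrite -mul_polyC rmorphM rhoC -scalerAl mul1r. Qed.

Lemma free_cells a : free [seq rho (cell_form rc) | rc <- cells P & a rc].
Proof.
set s := [seq rc <- cells P | a rc].
have us : uniq s by rewrite filter_uniq ?uniq_cells.
set X := map _ _; apply/(@freeP _ _ _ (in_tuple X)) => k k0 i.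
have szX : size X = size s by rewrite size_map.
pose v rc := if rc \in s then k (insubd i (index rc s)) else 0.
have iP (j : 'I_(size X)) : (j < size s)%N by rewrite -szX.
have vE (j : 'I_(size X)) : v (nth (0, 0)%N s j) = k j.
  rewrite /v mem_nth // index_uniq //; congr k; apply: val_inj.
  by rewrite val_insubd ltn_ord.
have Iv : I (\sum_(rc <- cells P) (v rc)%:P *: cell_form rc).
  apply/ker_rho.
  rewrite rmorph_sum (bigID (mem s)) /= addrC big1 ?add0r; last first.
    by move=> rc /negPf nrc; rewrite /v nrc polyC0 scale0r rmorph0.
  rewrite big_seq_cond (eq_bigl (fun rc => (rc \in cells P) && a rc)); last first.
    by move=> rc; rewrite mem_filter andbC -andbA andbb andbC.
  rewrite -big_seq_cond -big_filter -/s (big_nth (0, 0)%N) -szX big_mkord.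
  rewrite -[RHS]k0; apply: eq_bigr => j _.
  by rewrite rhoZ vE (nth_map (0, 0)%N).
rewrite -vE; apply: (cells_independent Iv).
by have := mem_nth (0, 0)%N (iP i); rewrite mem_filter => /andP[].
Qed.

Lemma span_cells a u : spanned_mod a u ->
  rho u \in <<[seq rho (cell_form rc) | rc <- cells P & a rc]>>%VS.
Proof.
case=> v /ker_rho; rewrite rmorphB => /eqP; rewrite subr_eq0 => /eqP->.
rewrite rmorph_sum big_seq_cond; apply: memv_suml => rc /andP[rcP arc].
rewrite rhoZ; apply/memvZ/memv_span/mapP; exists rc => //.
by rewrite mem_filter arc.
Qed.

(** Multiplication by [x] moves a cell one column to the right, so row [r] is a string of length
    [P_r]. *)
Lemma jordan_type_cells : sorted geq P -> 0%N \notin P ->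
  nilpotent_jordan_type (fun y => rho 'X%:P * y) P.
Proof.
move=> sP nzP; split=> //.
exists [seq rho (hform (beta b)) | b <- iota 0 (size P)].
  by rewrite size_map size_iota.
have iterE c u : iter c (fun y => rho 'X%:P * y) (rho u) = rho ('X^c *: u).
  elim: c => [|c IH]; first by rewrite expr0 scale1r.
  by rewrite iterS IH -rmorphM mul_polyC scalerA exprS.
split=> [r lt_r|].
  rewrite (nth_map 0%N) ?size_iota // nth_iota // add0n iterE; apply/ker_rho.
  pose c b : {poly K} := if b == r then 'X^(nth 0%N P r) else 0.
  have -> : 'X^(nth 0%N P r) *: hform (beta r) =
      \sum_(b < size P) c b *: hform (beta b).
    rewrite (bigD1 (Ordinal lt_r)) //= /c eqxx big1 ?addr0 // => b ne_br.
    by rewrite ifN ?scale0r.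
  apply/adapted_beta => b lt_b; rewrite /c; case: eqP => [->|_].
    by exists 1; rewrite mulr1.
  by exists 0; rewrite mulr0.
have -> : flatten [seq traject (fun y => rho 'X%:P * y) mv.2 mv.1
      | mv <- zip P [seq rho (hform (beta b)) | b <- iota 0 (size P)]] =
    [seq rho (cell_form rc) | rc <- cells P].
  rewrite /cells map_allpairs; congr flatten.
  apply: (@eq_from_nth _ [::]) => [|i].
    by rewrite !size_map size_zip size_map size_iota minnn.
  rewrite size_map size_zip size_map size_iota minnn => lt_i.
  rewrite (nth_map (0%N, 0)) ?size_zip ?size_map ?size_iota ?minnn //.
  rewrite nth_zip ?size_map ?size_iota //= (nth_map 0%N) ?size_iota //.
  rewrite [RHS](nth_map 0%N) ?size_iota // nth_iota // add0n trajectE.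
  by apply: eq_map => c; rewrite iterE.
rewrite /basis_of -[cells P]filter_predT free_cells andbT eqEsubv subvf.
apply/subvP => y _; have [u <-] := rho_surj y.
exact/span_cells/spanned_mod_all.
Qed.

(** The monomials of degree [D] and the cells of diagonal [D] have the same span, and the latter are
    free. *)
Lemma dim_degree_part D :
  \dim <<[seq rho (homogenize D 'X^b) | b <- iota 0 D.+1]>> =
    diagonal_length P D.
Proof.
pose C := [seq rho (cell_form rc) | rc <- cells P & (rc.1 + rc.2)%N == D].
set M := [seq rho (homogenize D 'X^b) | b <- iota 0 D.+1].
have -> : <<M>>%VS = <<C>>%VS.
  apply/eqP; rewrite eqEsubv; apply/andP; split; apply/span_subvP => y /mapP[].
    move=> b; rewrite mem_iota => /andP[_ lt_b] ->.
    by apply/span_cells/spanned_mod_form; rewrite size_polyXn.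
  move=> [r c]; rewrite mem_filter mem_cells /= => /and3P[/eqP Erc lt_r lt_c] ->.
  have [_ sr] := betaP lt_r.
  have -> : cell_form (r, c) = homogenize D (beta r).
    by rewrite /cell_form /hform sr /= -homogenize_shift ?sr // Erc.
  rewrite -[beta r]coefK poly_def homogenize_sum rmorph_sum.
  apply: memv_suml => b _; rewrite homogenizeZ rhoZ.
  apply/memvZ/memv_span/mapP; exists (b : nat) => //; rewrite mem_iota /=.
  by rewrite (leq_trans (ltn_ord b)) // sr -Erc ltnS leq_addr.
have /eqP -> := free_cells (fun rc => (rc.1 + rc.2)%N == D).
by rewrite size_map size_filter.
Qed.

End Quotient.

End AdaptedCells.

(** * Quotient algebras *)

(** An ideal with a finite basis of a complement. Elements of the quotient are coordinate rows, so
    the vector space structure is inherited and only a multiplication must be supplied. *)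
Record normal_forms (K : fieldType) (L : comAlgType K) := NormalForms {
  nf_ideal : L -> Prop;
  nf_basis : seq L;
  nf_idealD : forall u v, nf_ideal u -> nf_ideal v -> nf_ideal (u + v);
  nf_idealM : forall u v, nf_ideal v -> nf_ideal (u * v);
  nf_ideal_proper : ~ nf_ideal 1;
  nf_span : forall u, exists v : 'rV[K]_(size nf_basis),
    nf_ideal (u - \sum_i v 0 i *: nf_basis`_i);
  nf_free : forall v : 'rV[K]_(size nf_basis),
    nf_ideal (\sum_i v 0 i *: nf_basis`_i) -> v = 0 }.

Section QuotientAlgebra.

Variables (K : fieldType) (L : comAlgType K) (N : normal_forms L).

Local Notation I := (nf_ideal N).

Definition quotient_algebra := 'rV[K]_(size (nf_basis N)).

HB.instance Definition _ := Vector.copy quotient_algebra 'rV[K]_(size (nf_basis N)).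

Implicit Types v w : quotient_algebra.

Definition nf_lift v : L := \sum_i v 0 i *: (nf_basis N)`_i.

(** [nf_span] is a mere existence statement, so coordinates are chosen; freeness makes the choice
    unique. *)
Definition nf_proj (u : L) : quotient_algebra :=
  sval (constructive_indefinite_description _ (nf_span N u)).

Fact nf_projP u : I (u - nf_lift (nf_proj u)).
Proof. exact: (svalP (constructive_indefinite_description _ (nf_span N u))). Qed.

Fact nf_idealN u : I u -> I (- u).
Proof. by move=> Iu; rewrite -mulN1r; apply: nf_idealM. Qed.

Fact nf_idealB (u v : L) : I u -> I v -> I (u - v).
Proof. by move=> Iu Iv; apply: nf_idealD => //; apply: nf_idealN. Qed.

Fact nf_lift_linear : linear nf_lift.
Proof.
move=> a v w; rewrite /nf_lift scaler_sumr -big_split; apply: eq_bigr => i _.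
by rewrite !mxE scalerDl scalerA.
Qed.

HB.instance Definition _ := GRing.isLinear.Build K quotient_algebra L _ nf_lift
  nf_lift_linear.

Fact nf_proj_unique u v : I (u - nf_lift v) -> nf_proj u = v.
Proof.
move=> Iuv; apply/eqP; rewrite -subr_eq0; apply/eqP/(@nf_free _ _ N).
rewrite -/(nf_lift (nf_proj u - v)) linearB.
have := nf_idealB Iuv (nf_projP u); congr I; ring.
Qed.

Fact nf_liftK : cancel nf_lift nf_proj.
Proof.
move=> v; apply: nf_proj_unique; rewrite subrr.
by have := nf_idealB (nf_projP 0) (nf_projP 0); rewrite subrr.
Qed.

Fact eq_nf_proj u u' : I (u - u') -> nf_proj u = nf_proj u'.
Proof.
move=> Iu; apply: nf_proj_unique.
have := nf_idealD Iu (nf_projP u'); congr I; ring.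
Qed.

Fact nf_proj_linear : linear nf_proj.
Proof.
move=> a u u'; apply: nf_proj_unique; rewrite linearP.
have := nf_idealD (nf_idealM a%:A (nf_projP u)) (nf_projP u').
congr I; rewrite mulr_algl scalerBr; ring.
Qed.

HB.instance Definition _ := GRing.isLinear.Build K L quotient_algebra _ nf_proj
  nf_proj_linear.

Definition quotient_mul v w := nf_proj (nf_lift v * nf_lift w).

(** With representatives [v] and [v'], one has [u u' - v v' = u' (u - v) + v (u' - v')]. The ring
    laws of the quotient are then pulled down from [L]. *)
Fact nf_projM u u' : nf_proj (u * u') = quotient_mul (nf_proj u) (nf_proj u').
Proof.
apply: eq_nf_proj.
have := nf_idealD (nf_idealM u' (nf_projP u))
  (nf_idealM (nf_lift (nf_proj u)) (nf_projP u')).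
congr I; ring.
Qed.

Fact quotient_mulA : associative quotient_mul.
Proof.
move=> u v w; rewrite -(nf_liftK u) -(nf_liftK v) -(nf_liftK w).
by rewrite -!nf_projM mulrA.
Qed.

Fact quotient_mulC : commutative quotient_mul.
Proof. by move=> u v; rewrite /quotient_mul mulrC. Qed.

Fact quotient_mul1 : left_id (nf_proj 1) quotient_mul.
Proof. by move=> u; rewrite -(nf_liftK u) -nf_projM mul1r. Qed.

Fact quotient_mulDl : left_distributive quotient_mul +%R.
Proof. by move=> u v w; rewrite /quotient_mul linearD mulrDl linearD. Qed.

Fact quotient_one_neq0 : nf_proj 1 != 0.
Proof.
apply/eqP => E; apply: (@nf_ideal_proper _ _ N).
by have := nf_projP 1; rewrite E linear0 subr0.
Qed.

HB.instance Definition _ := GRing.Zmodule_isComNzRing.Build quotient_algebra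
  quotient_mulA quotient_mulC quotient_mul1 quotient_mulDl quotient_one_neq0.

Fact quotient_scaleAl (a : K) v w : a *: (v * w) = (a *: v) * w.
Proof.
rewrite -[LHS]/(a *: quotient_mul v w) -[RHS]/(quotient_mul (a *: v) w).
by rewrite /quotient_mul linearZ -scalerAl linearZ.
Qed.

HB.instance Definition _ := GRing.Lmodule_isLalgebra.Build K quotient_algebra
  quotient_scaleAl.
HB.instance Definition _ := GRing.Lalgebra_isComAlgebra.Build K quotient_algebra.
HB.instance Definition _ := Algebra_isFalgebra.Build K quotient_algebra.

Fact nf_proj_monoid_morphism : monoid_morphism nf_proj.
Proof. by split=> // u v; rewrite nf_projM. Qed.

HB.instance Definition _ := GRing.isMonoidMorphism.Build L quotient_algebra
  nf_proj nf_proj_monoid_morphism.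

Lemma quotient_algebraP : exists (A : falgType K) (pi : {lrmorphism L -> A}),
  (forall y, exists u, pi u = y) /\ (forall u, pi u = 0 <-> I u).
Proof.
exists quotient_algebra, nf_proj; split=> [v|u].
  by exists (nf_lift v); apply: nf_liftK.
split=> [E|Iu].
  by have := nf_projP u; rewrite (E : nf_proj u = 0) linear0 subr0.
by apply: nf_proj_unique; rewrite linear0 subr0.
Qed.

End QuotientAlgebra.

(** * Linear changes of coordinates *)

Section CoordinateChange.

Variable K : fieldType.
Local Notation R := {mpoly K[2]}.
Local Notation R' := {poly {poly K}}.
Local Notation X := ('X_ord0 : R).
Local Notation Y := ('X_ord_max : R).

Lemma poly_poly_rmorph_ext (S : nzRingType) (phi psi : {rmorphism R' -> S}) :
    (forall x : K, phi x%:P%:P = psi x%:P%:P) -> phi 'X%:P = psi 'X%:P ->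
    phi 'X = psi 'X ->
  phi =1 psi.
Proof.
move=> eqC eqX eqY u; rewrite -[u]coefK poly_def !rmorph_sum.
apply: eq_bigr => i _; rewrite -mul_polyC !rmorphM !rmorphXn eqY; congr (_ * _).
rewrite -[u`_i]coefK poly_def rmorph_sum !rmorph_sum; apply: eq_bigr => j _.
by rewrite -mul_polyC !rmorphM !rmorphXn eqX eqC.
Qed.

Lemma mpoly2_rmorph_ext (S : nzRingType) (phi psi : {rmorphism R -> S}) :
    (forall x : K, phi x%:MP = psi x%:MP) -> phi X = psi X -> phi Y = psi Y ->
  phi =1 psi.
Proof.
move=> eqC eqX eqY u; rewrite (mpolyE u) !rmorph_sum; apply: eq_bigr => m _.
rewrite -mul_mpolyC mpolyXE_id !rmorphM eqC big_ord_recl big_ord1.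
rewrite (_ : lift ord0 ord0 = ord_max); last exact: val_inj.
by rewrite !rmorphM !rmorphXn eqX eqY.
Qed.

Lemma dhomog1_mpoly2 (l : R) : l \is 1.-homog ->
  l = l@_U_(ord0) *: X + l@_U_(ord_max) *: Y.
Proof.
move=> hl; apply/mpolyP => m; rewrite mcoeffD !mcoeffZ.
have [/mdeg1P[i /eqP ->]|deg_m] := boolP (mdeg m == 1%N); last first.
  have neU i : (U_(i)%MM == m) = false.
    by apply: contraNF deg_m => /eqP <-; rewrite mdeg1.
  by rewrite (dhomog_nemf_coeff hl deg_m) !mcoeffX !neU !mulr0 addr0.
rewrite !mcoeffXU; have [->|->] : i = ord0 \/ i = ord_max.
- by case: i => [[|[|]]] // lt_i; [left | right]; apply: val_inj.
- by rewrite eqxx mulr1 mulr0 addr0.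
- by rewrite eqxx mulr1 mulr0 add0r.
Qed.

Lemma commr_rmorph_comm (aR : nzSemiRingType) (rR : comNzRingType)
    (phi : aR -> rR) (u : rR) : commr_rmorph phi u.
Proof. by move=> x; apply: mulrC. Qed.

Variables a b c d : K.

Let l : R := a *: X + b *: Y.
Let l' : R := c *: X + d *: Y.

Definition eval_poly_poly : {rmorphism R' -> R} :=
  horner_morph (commr_rmorph_comm
    (horner_morph (commr_rmorph_comm (mpolyC 2 (R:=K)) l)) l').

Lemma eval_poly_polyC x : eval_poly_poly x%:P%:P = x%:MP.
Proof. by rewrite /eval_poly_poly /= horner_morphC /= horner_morphC. Qed.

Lemma eval_poly_polyX : eval_poly_poly 'X%:P = l.
Proof. by rewrite /eval_poly_poly /= horner_morphC /= horner_morphX. Qed.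

Lemma eval_poly_polyY : eval_poly_poly 'X = l'.
Proof. by rewrite /eval_poly_poly /= horner_morphX. Qed.

Let det := a * d - b * c.

(** Cramer's rule for [X] and [Y] in terms of [l] and [l'], dehomogenized by putting [l = 1]. *)
Definition inverse_form (i : 'I_2) : {poly K} :=
  if i == ord0 then (d / det)%:P - (b / det) *: 'X
  else (a / det) *: 'X - (c / det)%:P.

Definition eval_mpoly : {rmorphism R -> R'} :=
  mmap (polyC \o polyC) (fun i => homogenize 1 (inverse_form i)).

Lemma eval_mpolyC x : eval_mpoly x%:MP = x%:P%:P.
Proof. by rewrite /eval_mpoly /= mmapC. Qed.

Lemma eval_mpolyZ x p : eval_mpoly (x *: p) = x%:P%:P * eval_mpoly p.
Proof. by rewrite -mul_mpolyC rmorphM eval_mpolyC. Qed.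

Lemma eval_poly_polyZ x u : eval_poly_poly (x%:P *: u) = x *: eval_poly_poly u.
Proof. by rewrite -mul_polyC rmorphM eval_poly_polyC mul_mpolyC. Qed.

Lemma homogenize1_lin (x y : K) :
  homogenize 1 (x%:P + y *: 'X) = x%:P%:P * 'X%:P + y%:P%:P * 'X.
Proof.
rewrite homogenizeE big_ord_recl big_ord1 !coefD !coefC !coefZ !coefX /=.
rewrite mulr0 addr0 mulr1 add0r /bump /= addn0 subn0 subnn.
rewrite !expr0 !expr1 alg_polyC.
by rewrite -!mul_polyC mulr1 polyCM.
Qed.

Lemma eval_mpoly_var i : eval_mpoly 'X_i = homogenize 1 (inverse_form i).
Proof. by rewrite /eval_mpoly /= mmapX mmap1U. Qed.

Lemma eval_mpolyX :
  eval_mpoly X = (d / det)%:P%:P * 'X%:P - (b / det)%:P%:P * 'X.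
Proof.
rewrite eval_mpoly_var /inverse_form eqxx -scaleNr homogenize1_lin.
by rewrite !polyCN mulNr.
Qed.

Lemma eval_mpolyY :
  eval_mpoly Y = (a / det)%:P%:P * 'X - (c / det)%:P%:P * 'X%:P.
Proof.
rewrite eval_mpoly_var /inverse_form /= addrC -polyCN homogenize1_lin.
by rewrite !polyCN mulNr addrC.
Qed.

Lemma eval_homogenize D (f : {poly K}) :
  eval_poly_poly (homogenize D f) \is D.-homog.
Proof.
have hl (x y : K) : x *: X + y *: Y \is 1.-homog.
  by apply: dhomogD; apply: dhomogZ; rewrite dhomogX; apply/eqP/mdeg1.
rewrite homogenizeE rmorph_sum; apply: rpred_sum => i _.
rewrite -!mul_polyC polyCM polyC_exp !rmorphM !rmorphXn eval_poly_polyC.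
rewrite eval_poly_polyX eval_poly_polyY mul_mpolyC.
move: (nat_of_ord i) (ltn_ord i) => {}i le_iD.
suff : f`_i *: l ^+ (D - i) * l' ^+ i \is (D - i + i).-homog by rewrite subnK.
have hX k (q : R) : q \is 1.-homog -> q ^+ k \is k.-homog.
  by move=> hq; have := dhomogMn k hq; rewrite mul1n.
by apply: dhomogM; [apply: dhomogZ|]; apply/hX/hl.
Qed.

(** A monomial [m] goes to a product of [mdeg m] linear forms, and [homogenizeM] collects them into
    one homogenization. *)
Lemma eval_mpoly_homog D (p : R) : p \is D.-homog ->
  exists2 f : {poly K}, (size f <= D.+1)%N & eval_mpoly p = homogenize D f.
Proof.
move=> /dhomogP hp.
pose e (m : 'X_{1..2}) :=
  inverse_form ord0 ^+ m ord0 * inverse_form ord_max ^+ m ord_max.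
have size_lin i : (size (inverse_form i) <= 2)%N.
  rewrite /inverse_form; case: ifP => _; rewrite (leq_trans (size_polyD _ _)) //;
  by rewrite geq_max size_polyN (leq_trans (size_scale_leq _ _)) ?size_polyX //
    (leq_trans (size_polyC_leq1 _)).
have powE i k : (size (inverse_form i ^+ k) <= k.+1)%N /\
    homogenize k (inverse_form i ^+ k) = homogenize 1 (inverse_form i) ^+ k.
  elim: k => [|k [IHs IH]]; first by rewrite !expr0 size_poly1 homogenize1.
  rewrite !exprS -IH -homogenizeM //; split=> //.
  rewrite (leq_trans (size_polyMleq _ _)) // -ltnS.
  have := size_lin i; rewrite -subn1; lia.
have eE m : (size (e m) <= (mdeg m).+1)%N /\
    eval_mpoly 'X_[m] = homogenize (mdeg m) (e m).
  have -> : mdeg m = (m ord0 + m ord_max)%N.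
    rewrite mdegE big_ord_recl big_ord1; congr (_ + m _)%N; exact: val_inj.
  have [[s0 E0] [s1 E1]] := (powE ord0 (m ord0), powE ord_max (m ord_max)).
  split.
    rewrite (leq_trans (size_polyMleq _ _)) // -subn1 leq_subLR add1n.
    by rewrite -addSn -addnS leq_add.
  rewrite homogenizeM // E0 E1 mpolyXE_id rmorph_prod big_ord_recl big_ord1.
  rewrite (_ : lift ord0 ord0 = ord_max); last exact: val_inj.
  by rewrite !rmorphXn !eval_mpoly_var.
exists (\sum_(m <- msupp p) p@_m *: e m).
  apply/leq_sizeP => i lt_i; rewrite coef_sum big1_seq // => m /= pm.
  have [sm _] := eE m; rewrite coefZ [(e m)`_i]nth_default ?mulr0 //.
  by rewrite (leq_trans sm) // hp.
rewrite {1}(mpolyE p) rmorph_sum homogenize_sum !big_seq; apply: eq_bigr => m pm.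
have [_ Em] := eE m; rewrite -(hp m pm) homogenizeZ -Em -mul_mpolyC rmorphM.
by rewrite eval_mpolyC mul_polyC.
Qed.

Hypothesis det_neq0 : a * d - b * c != 0.

Lemma eval_polyK : cancel eval_poly_poly eval_mpoly.
Proof.
have CE (x y : K) : x%:P%:P * y%:P%:P = (x * y)%:P%:P :> R' by rewrite -!polyCM.
apply: (@poly_poly_rmorph_ext _ (eval_mpoly \o eval_poly_poly) idfun)
  => [x||] /=.
- by rewrite eval_poly_polyC eval_mpolyC.
- rewrite eval_poly_polyX rmorphD !eval_mpolyZ eval_mpolyX eval_mpolyY.
  rewrite !mulrBr !mulrA !CE.
  have -> : a * (d / det) = 1 + b * (c / det) by rewrite /det; field.
  have -> : b * (a / det) = a * (b / det) by ring.
  rewrite !polyCD; ring.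
- rewrite eval_poly_polyY rmorphD !eval_mpolyZ eval_mpolyX eval_mpolyY.
  rewrite !mulrBr !mulrA !CE.
  have -> : d * (a / det) = 1 + c * (b / det) by rewrite /det; field.
  have -> : d * (c / det) = c * (d / det) by ring.
  rewrite !polyCD; ring.
Qed.

Lemma eval_mpolyK : cancel eval_mpoly eval_poly_poly.
Proof.
apply: (@mpoly2_rmorph_ext _ (eval_poly_poly \o eval_mpoly) idfun) => [x||] /=.
- by rewrite eval_mpolyC eval_poly_polyC.
- rewrite eval_mpolyX !mul_polyC rmorphB !eval_poly_polyZ.
  rewrite eval_poly_polyX eval_poly_polyY.
  rewrite /l /l' !scalerDr !scalerA.
  have -> : d / det * a = 1 + b / det * c by rewrite /det; field.
  have -> : d / det * b = b / det * d by ring.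
  by rewrite scalerDl scale1r opprD addrACA addrK addrN addr0.
- rewrite eval_mpolyY !mul_polyC rmorphB !eval_poly_polyZ.
  rewrite eval_poly_polyX eval_poly_polyY.
  rewrite /l /l' !scalerDr !scalerA.
  have -> : a / det * d = 1 + c / det * b by rewrite /det; field.
  have -> : a / det * c = c / det * a by ring.
  by rewrite scalerDl scale1r opprD addrACA subrr add0r addrK.
Qed.

End CoordinateChange.

(** * Reduction of a regular pair *)

Section RegularPairs.

Variable K : fieldType.
Local Notation R' := {poly {poly K}}.

(** The second clause of [regular_sequence2]: [g] is a nonzerodivisor modulo [f]. *)
Definition coprime_pair (f g : R') : Prop :=
  forall w z : R', w * g = z * f -> exists q, w = q * f.

Lemma coprime_pair_sym (f g : R') : f != 0 -> g != 0 ->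
  coprime_pair f g -> coprime_pair g f.
Proof.
move=> f0 g0 cop w z /esym E; have [q Eq] := cop _ _ E.
exists q; apply: (mulIf f0); rewrite -E Eq; ring.
Qed.

(* A Bezout relation between [F] and [G] homogenizes to one for a power of [x]. *)
Lemma coprimep_coprime_pair (F G : {poly K}) e :
    F \is monic -> G \is monic -> coprimep F G ->
  coprime_pair (hform F) ('X^e *: hform G).
Proof.
move=> mF mG /Bezout_eq1_coprimepP[[U V] /= EUV] w z Ewz.
have sF : (0 < size F)%N by rewrite size_poly_gt0 monic_neq0.
have sG : (0 < size G)%N by rewrite size_poly_gt0 monic_neq0.
(* Large enough for [U] and [V] to have degrees at most [N - deg F] and [N - deg G]. *)
pose N := (size U + size V + (size F).-1 + (size G).-1)%N.
have [U' [V' EN]] : exists U' V', U' * hform F + V' * hform G = ('X^N)%:P :> R'.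
  exists (homogenize (N - (size F).-1) U), (homogenize (N - (size G).-1) V).
  rewrite /hform -!homogenizeM ?leqSpred //; last 2 first.
  - by apply: leqW; rewrite /N; lia.
  - by apply: leqW; rewrite /N; lia.
  rewrite !subnK; [|by rewrite /N; lia|by rewrite /N; lia].
  by rewrite -homogenizeD EUV -(expr0 'X) homogenizeXn // subn0 expr0 alg_polyC.
have mFF := hform_monic mF.
have Ew := Pdiv.RingMonic.rdivp_eq mFF w.
set q := Pdiv.Ring.rdivp _ _ in Ew; set r := Pdiv.Ring.rmodp _ _ in Ew.
have sr : (size r < size (hform F))%N.
  by rewrite Pdiv.CommonRing.ltn_rmodpN0 // monic_neq0.
exists q; rewrite [LHS]Ew; suff -> : r = 0 by rewrite addr0.
(* Multiplying the Bezout relation by [x^e w] and using [w x^e G = z F] makes [x^(e + N) w] a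
   multiple of [F], so its remainder [x^(e + N) r] vanishes. *)
have [] := @monic_division_unique _ (hform F) ('X^(e + N) *: q)
  ('X^(e + N) *: r) ('X^e *: (w * U') + V' * z) 0 mFF.
- by rewrite (leq_ltn_trans (size_scale_leq _ _)).
- by rewrite size_poly0 size_poly_gt0 monic_neq0.
- rewrite -scalerAl -scalerDr -Ew exprD -scalerA -['X^N *: w]mul_polyC -EN addr0.
  rewrite -!mul_polyC [RHS]mulrDl -[V' * z * _]mulrA -Ewz -!mul_polyC; ring.
move=> _ /eqP; rewrite -mul_polyC mulf_eq0 polyC_eq0 expf_eq0 polyX_eq0 andbF.
by move/eqP.
Qed.

Lemma monic_mul_small (R : idomainType) (d q w : {poly R}) :
  d \is monic -> w = q * d -> (size w < size d)%N -> w = 0.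
Proof.
move=> md Ew sw.
have [] := @monic_division_unique _ d 0 w q 0 md sw => //.
- by rewrite size_poly0 size_poly_gt0 monic_neq0.
- by rewrite mul0r add0r addr0.
Qed.

(** Here the first form is monic in [y] up to a scalar, and the second is replaced by its remainder.
    The disjunction keeps the [y]-degree of that remainder below [E], whence [e > 0]. *)
Lemma ci_ideal_reduction_monic (D E : nat) (f g : {poly K}) :
    size f = D.+1 -> (size g <= E.+1)%N -> (D <= E)%N || (size g <= E)%N ->
    coprime_pair (homogenize D f) (homogenize E g) ->
    ~ generated2 (homogenize D f) (homogenize E g) 1 ->
  exists F G e, [/\ F \is monic, G \is monic, (size G < size F)%N,
    coprimep F G & (0 < e)%N /\
    forall u, generated2 (homogenize D f) (homogenize E g) u <-> ci_ideal F G e u].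
Proof.
move=> sf sg DE cop proper.
set f' := homogenize D f in cop proper *.
set g' := homogenize E g in cop proper *.
pose c := lead_coef f.
have c0 : c != 0 by rewrite lead_coef_eq0 -size_poly_eq0 sf.
pose F : {poly K} := c^-1 *: f.
have sF : size F = D.+1 by rewrite size_scale ?invr_eq0.
have mF : F \is monic by rewrite monicE lead_coefZ mulVf.
have Ef' : f' = c%:P%:P * hform F.
  rewrite mul_polyC /hform -homogenizeZ sF scalerA mulfV // scale1r //.
have mFF := hform_monic mF.
have [Q [r [Eg' sr srE]]] : exists Q (r : {poly K}),
    [/\ g' = Q * hform F + homogenize E r, (size r < size F)%N & (size r <= E)%N].
  have [le_gD|lt_Dg] := leqP (size g) D.
    exists 0, g; rewrite mul0r add0r sF ltnS; split=> //.
    by case/orP: DE => // le_DE; apply: leq_trans le_DE.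
  have le_DE : (D <= E)%N by rewrite -ltnS (leq_trans lt_Dg).
  have sr : (size (g %% F)%R < size F)%N by rewrite ltn_modp monic_neq0.
  exists (homogenize (E - D) (g %/ F)), (g %% F); split=> //; last first.
    by rewrite (leq_trans _ le_DE) // -ltnS -sF.
  rewrite /hform sF -homogenizeM ?sF //; last first.
    by rewrite size_divp ?monic_neq0 // sF -subSn // leq_sub2r.
  by rewrite subnK // -homogenizeD -divp_eq.
(* Otherwise the second form is a multiple of the first, and regularity applied to [w = 1] makes the
   ideal improper. *)
have r0 : r != 0.
  apply/eqP => Er; apply: proper.
  have [|q Eq] := cop 1 (Q * c^-1%:P%:P).
    rewrite Eg' Er homogenize0 addr0 Ef' mul1r -mulrA; congr (_ * _).
    by rewrite mulrA -!polyCM mulVf // mul1r.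
  by exists q, 0; rewrite mul0r addr0.
pose k := lead_coef r; have k0 : k != 0 by rewrite lead_coef_eq0.
pose G : {poly K} := k^-1 *: r.
have sG : size G = size r by rewrite size_scale ?invr_eq0.
have mG : G \is monic by rewrite monicE lead_coefZ mulVf.
have sr0 : (0 < size r)%N by rewrite size_poly_gt0.
pose e := (E - (size r).-1)%N.
have ErE : homogenize E r = k%:P%:P * ('X^e *: hform G).
  rewrite /hform -homogenize_shift ?leqSpred // sG mul_polyC -homogenizeZ.
  by rewrite scalerA mulfV // scale1r subnKC // -ltnS prednK // ltnW.
exists F, G, e; rewrite sG; split=> //; last first.
  split; first by rewrite /e; lia.
  have EFF : hform F = c^-1%:P%:P * f'.
    by rewrite Ef' mulrA -!polyCM mulVf // mul1r.
  have EXG : 'X^e *: hform G = k^-1%:P%:P * (g' - Q * hform F).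
    by rewrite Eg' addrC addKr ErE mulrA -!polyCM mulVf // mul1r.
  move=> u; split=> -[a [b ->]].
    by exists (a * c%:P%:P + b * Q), (b * k%:P%:P); rewrite Eg' ErE Ef'; ring.
  exists (a * c^-1%:P%:P - b * k^-1%:P%:P * Q * c^-1%:P%:P), (b * k^-1%:P%:P).
  rewrite EXG EFF; ring.
(* If [h] is the gcd and [F = F2 h], the form of [F2] times the second generator is a multiple of
   [F]. Regularity makes [F] divide this form, of lower degree unless [h] is constant. *)
rewrite coprimep_def; set h := gcdp F G.
have h0 : h != 0 by rewrite gcdp_eq0 negb_and monic_neq0.
have sh0 : (0 < size h)%N by rewrite size_poly_gt0.
have [F2 EF2] : exists F2, F = F2 * h.
  by exists (F %/ h); rewrite divpK // dvdp_gcdl.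
have [G2 EG2] : exists G2, G = G2 * h.
  by exists (G %/ h); rewrite divpK // dvdp_gcdr.
have sF2 : size F = (size F2 + (size h).-1)%N.
  have F20 : F2 != 0.
    by apply: contraNneq (monic_neq0 mF) => F20; rewrite EF2 F20 mul0r.
  by rewrite {1}EF2 size_mul //; lia.
have sG2 : size G = (size G2 + (size h).-1)%N.
  have G20 : G2 != 0.
    by apply: contraNneq (monic_neq0 mG) => G20; rewrite EG2 G20 mul0r.
  by rewrite {1}EG2 size_mul //; lia.
pose H := homogenize (size h).-1 h.
have splitM (M M2 : {poly K}) : M = M2 * h -> M != 0 ->
    size M = (size M2 + (size h).-1)%N ->
    hform M = homogenize (size M2).-1 M2 * H.
  move=> EM M0 sM; rewrite /hform -homogenizeM ?leqSpred // -EM; congr homogenize.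
  suff : (0 < size M2)%N by lia.
  by rewrite size_poly_gt0; apply: contraNneq M0 => M20; rewrite EM M20 mul0r.
have EFF := splitM F F2 EF2 (monic_neq0 mF) sF2.
have EGG := splitM G G2 EG2 (monic_neq0 mG) sG2.
set w := homogenize _ F2 in EFF; set v := homogenize _ G2 in EGG.
have [|q Eq] := cop w (c^-1%:P%:P * (w * Q + k%:P%:P * ('X^e)%:P * v)).
  have -> : c^-1%:P%:P * (w * Q + k%:P%:P * ('X^e)%:P * v) * f' =
      (w * Q + k%:P%:P * ('X^e)%:P * v) * hform F * (c^-1 * c)%:P%:P.
    by rewrite Ef' !polyCM; ring.
  by rewrite mulVf // mulr1 Eg' ErE -mul_polyC EGG EFF; ring.
have [//|h_neq1] := eqVneq (size h) 1%N.
have w0 : w = 0.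
  apply: (monic_mul_small mFF (q := q * c%:P%:P)).
    by rewrite Eq Ef' mulrA.
  rewrite [X in (_ < X)%N]size_hform //; apply: (leq_ltn_trans (size_poly _ _)).
  rewrite sF2.
  have sF20 : (0 < size F2)%N.
    rewrite size_poly_gt0; apply: contraNneq (monic_neq0 mF) => F20.
    by rewrite EF2 F20 mul0r.
  rewrite prednK // -[X in (X < _)%N]addn0 ltn_add2l -subn1 subn_gt0.
  by rewrite ltn_neqAle eq_sym h_neq1.
by have := monic_neq0 mFF; rewrite EFF w0 mul0r eqxx.
Qed.

Lemma ci_ideal_reduction (D E : nat) (f g : {poly K}) :
    (size f <= D.+1)%N -> (size g <= E.+1)%N ->
    homogenize D f != 0 -> homogenize E g != 0 ->
    coprime_pair (homogenize D f) (homogenize E g) ->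
    ~ generated2 (homogenize D f) (homogenize E g) 1 ->
  exists F G e, [/\ F \is monic, G \is monic, (size G < size F)%N,
    coprimep F G & (0 < e)%N /\
    forall u, generated2 (homogenize D f) (homogenize E g) u <-> ci_ideal F G e u].
Proof.
move=> sf sg f0 g0 cop proper.
have gen_sym u : generated2 (homogenize D f) (homogenize E g) u <->
    generated2 (homogenize E g) (homogenize D f) u.
  by split=> -[a [b ->]]; exists b, a; rewrite addrC.
have swap : size g = E.+1 -> (E <= D)%N || (size f <= D)%N ->
  exists F G e, [/\ F \is monic, G \is monic, (size G < size F)%N,
    coprimep F G & (0 < e)%N /\
    forall u, generated2 (homogenize D f) (homogenize E g) u <-> ci_ideal F G e u].
  move=> sgE ED.
  have [||F [G [e [mF mG lt_GF coFG [e0 Iu]]]]] :=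
    ci_ideal_reduction_monic sgE sf ED.
  - exact: coprime_pair_sym.
  - by move/gen_sym.
  by exists F, G, e; split=> //; split=> // u; split=> [/gen_sym/Iu|/Iu/gen_sym].
have [sfD|ltfD] := eqVneq (size f) D.+1.
  have [DE|] := boolP ((D <= E)%N || (size g <= E)%N).
    exact: ci_ideal_reduction_monic.
  (* Failure of the degree condition means [E < D] with [g] of full degree [E], so the roles are
     exchanged. *)
  rewrite negb_or -!ltnNge => /andP[ltED ltEg]; apply: swap; last by rewrite ltnW.
  by apply/eqP; rewrite eqn_leq sg.
have {}sf : (size f <= D)%N by rewrite -ltnS ltn_neqAle ltfD.
have [sgE|ltgE] := eqVneq (size g) E.+1; first by apply: swap; rewrite // sf orbT.
have {}sg : (size g <= E)%N by rewrite -ltnS ltn_neqAle ltgE.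
(* Neither form is monic, so [x] is a common factor. *)
have divX M (h : {poly K}) : (size h <= M)%N -> homogenize M h != 0 ->
    exists2 h', homogenize M h = 'X *: h' & h' != 0.
  move=> sh nz; case: M => [|M] in sh nz *.
    have h0 : h = 0 by apply/eqP; rewrite -size_poly_eq0 -leqn0.
    by rewrite h0 homogenize0 eqxx in nz.
  have Eh : homogenize M.+1 h = 'X *: homogenize M h.
    by rewrite -addn1 homogenize_shift // expr1.
  exists (homogenize M h) => //.
  by apply: contraNneq nz => h0; rewrite Eh h0 scaler0.
have [f' Ef f'0] := divX _ _ sf f0; have [g' Eg g'0] := divX _ _ sg g0.
(* Cancelling the common [x], regularity would make [f'] a multiple of [x f'], hence [x] a unit. *)
have [|q Eq] := cop f' g'; first by rewrite Eg Ef -!scalerAr mulrC.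
have /eqP := Eq; rewrite Ef -scalerAr scalerAl -[X in X == _]mul1r.
move/eqP/(mulIf f'0) => E1.
have := congr1 (fun u : R' => u`_0`_0) E1.
by rewrite coefC coefZ coefXM /= coef1 => /eqP; rewrite oner_eq0.
Qed.

End RegularPairs.

(** * Complete intersections and blocks *)

Section Presentation.

Variables (K : fieldType) (a b c d : K) (A : falgType K).
Variable pi : {lrmorphism {mpoly K[2]} -> A}.
Hypothesis det_neq0 : a * d - b * c != 0.
Hypothesis pi_surj : forall y : A, exists p, pi p = y.

Definition coordinate_presentation : {rmorphism {poly {poly K}} -> A} :=
  pi \o eval_poly_poly a b c d.

Lemma coordinate_presentationC (x : K) : coordinate_presentation x%:P%:P = x%:A.
Proof. by rewrite /= eval_poly_polyC -alg_mpolyC linearZ rmorph1. Qed.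

Lemma coordinate_presentation_surj y : exists u, coordinate_presentation u = y.
Proof.
have [p <-] := pi_surj y.
by exists (eval_mpoly a b c d p); rewrite /= eval_mpolyK.
Qed.

Lemma ideal2_eval (f g p : {mpoly K[2]}) :
  ideal2 f g p <-> generated2 (eval_mpoly a b c d f) (eval_mpoly a b c d g)
                     (eval_mpoly a b c d p).
Proof.
split=> -[u [v E]].
  exists (eval_mpoly a b c d u), (eval_mpoly a b c d v).
  by rewrite E rmorphD !rmorphM.
exists (eval_poly_poly a b c d u), (eval_poly_poly a b c d v).
rewrite -[LHS](eval_mpolyK det_neq0) E rmorphD !rmorphM.
by rewrite !(eval_mpolyK det_neq0).
Qed.

Lemma ker_coordinate_presentation (f g : {mpoly K[2]}) :
    (forall p, pi p = 0 <-> ideal2 f g p) ->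
  forall u, coordinate_presentation u = 0 <->
    generated2 (eval_mpoly a b c d f) (eval_mpoly a b c d g) u.
Proof.
move=> ker u; rewrite -{2}(eval_polyK det_neq0 u).
by split=> [/ker/ideal2_eval|/ideal2_eval/ker].
Qed.

End Presentation.

(** Euclid's algorithm, run in coordinates where [l] is [x], exhibits one Jordan type of [l];
    uniqueness identifies it with [q]. *)
Lemma ci_jordan_type_blocks (K : fieldType) (A : falgType K)
    (pi : {lrmorphism {mpoly K[2]} -> A}) (l : {mpoly K[2]}) (q : seq nat) :
    graded_CI_quotient pi -> l \is 1.-homog -> l != 0 ->
    linear_form_jordan_type pi l q ->
  exists t p n, ci_blocks t p n /\ q = power_partition t p n.
Proof.
case=> pi_surj [f [g [[D hf] [E hg] [f_reg g_reg proper] ker]]] hl l0 jt.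
set a := l@_U_(ord0); set b := l@_U_(ord_max).
have El : l = a *: 'X_ord0 + b *: 'X_ord_max := dhomog1_mpoly2 hl.
have [c [d det0]] : exists c d, a * d - b * c != 0.
  (* If [a = 0], the choice [(-1, 0)] has determinant [b], nonzero because [l] is. *)
  have [a0|a0] := eqVneq a 0; last by exists 0, 1; rewrite mulr0 subr0 mulr1.
  exists (-1), 0; rewrite mulr0 mulrN mulr1 opprK add0r.
  by apply: contraNneq l0 => b0; rewrite El a0 b0 !scale0r addr0.
pose Phi := eval_poly_poly a b c d; pose Psi := eval_mpoly a b c d.
have PsiK : cancel Psi Phi := eval_mpolyK det0.
have PhiK : cancel Phi Psi := eval_polyK det0.
have [f1 sf Ef] := eval_mpoly_homog a b c d hf.
have [g1 sg Eg] := eval_mpoly_homog a b c d hg.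
have Psi0 p : Psi p = 0 -> p = 0 by move=> E0; rewrite -(PsiK p) E0 rmorph0.
have f0 : Psi f != 0.
  by apply/eqP => /Psi0 f0; have /eqP := f_reg 1 (etrans (mul1r f) f0);
    rewrite oner_eq0.
have g0 : Psi g != 0.
  apply/eqP => /Psi0 g0; have [|u Eu] := g_reg 1.
    by exists 0; rewrite g0 mulr0 mul0r.
  by apply: proper; exists u, 0; rewrite mul0r addr0.
have cop : coprime_pair (Psi f) (Psi g).
  move=> w z Ewz; have [|u Eu] := g_reg (Phi w).
    exists (Phi z); apply: (can_inj PsiK).
    by rewrite !rmorphM !PhiK.
  by exists (Psi u); rewrite -rmorphM -Eu PhiK.
have prop : ~ generated2 (Psi f) (Psi g) 1.
  by move=> I1; apply/proper/(ideal2_eval det0); rewrite rmorph1.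
rewrite /Psi Ef in f0 cop prop; rewrite Eg in g0 cop prop.
have [F [G [e [mF mG lt_GF coFG [e0 IFG]]]]] :=
  ci_ideal_reduction sf sg f0 g0 cop prop.
have [t [p [n [blk pt nt szP [beta [betaP adP]]]]]] :=
  euclid_adapted mF mG lt_GF coFG e0.
exists t, p, n; split=> //.
set rho := coordinate_presentation a b c d pi.
have rho_ker u : rho u = 0 <-> ci_ideal F G e u.
  split=> [/(ker_coordinate_presentation det0 ker)|/IFG].
    by rewrite Ef Eg => /IFG.
  by rewrite -Ef -Eg => /(ker_coordinate_presentation det0 ker).
have [_ _ n_gt0 _] := blk; have [t_gt0 p_gt0 _ _] := blk.
have sF : size F = (size (power_partition t p n)).+1.
  by rewrite szP prednK // size_poly_gt0 monic_neq0.
have nz := power_partition_gt0 n_gt0 p_gt0.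
have IFF : generated2 (hform F) ('X^e *: hform G) (hform F).
  by exists 1, 0; rewrite mul1r mul0r addr0.
have jt' := @jordan_type_cells K _ _ _ F beta mF sF IFF betaP adP A rho
  (@coordinate_presentationC K a b c d A pi)
  (coordinate_presentation_surj det0 pi_surj) rho_ker
  (sorted_power_partition n (ci_blocks_decreasing blk)) nz.
(* Uniqueness asks for a linear map; [\*o] presents multiplication by [pi l] as one. *)
apply: (@nilpotent_jordan_type_uniq K A (pi l \*o idfun) q _ jt).
suff -> : pi l = rho 'X%:P by [].
by rewrite /rho /= eval_poly_polyX -El.
Qed.

Lemma ci_of_blocks (K : fieldType) t p n (P := power_partition t p n) :
    ci_blocks t p n ->
  exists (A : falgType K) (pi : {lrmorphism {mpoly K[2]} -> A})
      (l : {mpoly K[2]}),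
    [/\ graded_CI_quotient pi,
        forall i, hilbert_function pi i = diagonal_length P i,
        l \is 1.-homog, l != 0 & linear_form_jordan_type pi l P].
Proof.
move=> blk; have [t_gt0 p_gt0 n_gt0 _] := blk.
have [F [G [mF mG coFG sF [szP [beta [betaP adP]]]]]] := continuant_adapted K blk.
rewrite -/P in szP betaP adP; set e := p t in adP.
have e0 : (0 < e)%N by rewrite p_gt0 ?t_gt0 /=.
have sG : (0 < size G)%N by rewrite size_poly_gt0 monic_neq0.
have n_t : (0 < n t)%N by rewrite n_gt0 ?t_gt0 /=.
have sF1 : (1 < size F)%N by rewrite sF; lia.
have szF : size F = (size P).+1 by rewrite szP prednK // ltnW.
(* The identity change of coordinates merely translates between [{poly {poly K}}] and [{mpoly
   K[2]}]. *)
have det0 : 1 * 1 - 0 * 0 != 0 :> K by rewrite mulr0 subr0 mulr1 oner_eq0.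
pose Phi := eval_poly_poly 1 0 0 (1 : K); pose Psi := eval_mpoly 1 0 0 (1 : K).
have PsiK : cancel Psi Phi := eval_mpolyK det0.
have PhiK : cancel Phi Psi := eval_polyK det0.
have mFF := hform_monic mF; have mGG := hform_monic mG.
set HH := 'X^e *: hform G in adP.
pose f := Phi (hform F); pose g := Phi HH.
have idealE q : ideal2 f g q <-> ci_ideal F G e (Psi q).
  by split=> [/(ideal2_eval det0)|I]; last apply/(ideal2_eval det0);
    rewrite !PhiK.
have IFF : ci_ideal F G e (hform F) by exists 1, 0; rewrite mul1r mul0r addr0.
(* A constant in the ideal is a multiple of [x^e], and [e > 0]. *)
have proper : ~ ci_ideal F G e 1.
  case/(ci_ideal_reduced mF); first by rewrite size_poly1.
  move=> z [q [E1 _]]; have := congr1 (fun u : {poly {poly K}} => u`_0`_0) E1.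
  by rewrite coef1 coefC coefZ coefXnM e0 => /eqP; rewrite oner_eq0.
pose E := [seq Phi (cell_form beta rc) | rc <- cells P].
have sumE (v : nat * nat -> K) :
    Psi (\sum_(i < size E) v (nth (0, 0)%N (cells P) i) *: E`_i) =
    \sum_(rc <- cells P) (v rc)%:P *: cell_form beta rc.
  rewrite rmorph_sum (big_nth (0, 0)%N) big_mkord /E size_map.
  apply: eq_bigr => i _; rewrite (nth_map (0, 0)%N) //.
  by rewrite /Psi eval_mpolyZ -/Psi PhiK mul_polyC.
have szE : size E = size (cells P) by rewrite size_map.
have spanE u : exists v : 'rV[K]_(size E),
    ideal2 f g (u - \sum_i v 0 i *: E`_i).
  have [v Iv] := spanned_mod_all mF szF IFF betaP adP (Psi u).
  exists (\row_i v (nth (0, 0)%N (cells P) i)); apply/idealE.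
  rewrite rmorphB (eq_bigr (fun i : 'I_(size E) =>
    v (nth (0, 0)%N (cells P) i) *: E`_i)) ?sumE //.
  by move=> i _; rewrite mxE.
have freeE (v : 'rV[K]_(size E)) : ideal2 f g (\sum_i v 0 i *: E`_i) -> v = 0.
  pose w rc := if insub (index rc (cells P)) is Some i then v 0 i else 0.
  have wE (i : 'I_(size E)) : w (nth (0, 0)%N (cells P) i) = v 0 i.
    by rewrite /w index_uniq ?uniq_cells -?szE // valK.
  rewrite (eq_bigr (fun i : 'I_(size E) =>
    w (nth (0, 0)%N (cells P) i) *: E`_i)).
    move=> /idealE; rewrite sumE => /(cells_independent adP) w0.
    apply/rowP => i; rewrite mxE -wE; apply: w0.
    by rewrite mem_nth // -szE.
  by move=> i _; rewrite wE.
have idealD u v : ideal2 f g u -> ideal2 f g v -> ideal2 f g (u + v).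
  move=> /idealE Iu /idealE Iv; apply/idealE; rewrite rmorphD.
  exact: generated2D.
have idealM u v : ideal2 f g v -> ideal2 f g (u * v).
  by move=> /idealE Iv; apply/idealE; rewrite rmorphM; apply: generated2Ml.
have ideal_proper : ~ ideal2 f g 1 by move=> /idealE; rewrite rmorph1.
have [A [pi [pi_surj ker]]] := quotient_algebraP
  (NormalForms idealD idealM ideal_proper spanE freeE).
rewrite /= in ker.
set rho := coordinate_presentation 1 0 0 1 pi.
have rho_ker u : rho u = 0 <-> ci_ideal F G e u.
  have := ker_coordinate_presentation det0 ker u.
  by rewrite -/Psi /f /g !PhiK.
have rhoC := @coordinate_presentationC K 1 0 0 1 A pi.
have HHE : HH = homogenize ((size G).-1 + e) G.
  by rewrite homogenize_shift ?leqSpred.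
have evalX : Phi 'X%:P = 'X_ord0.
  by rewrite /Phi eval_poly_polyX scale1r scale0r addr0.
have evalY : Phi 'X = 'X_ord_max.
  by rewrite /Phi eval_poly_polyY scale1r scale0r add0r.
have rhoX : rho 'X%:P = pi 'X_ord0 by rewrite -evalX.
have rhoY : rho 'X = pi 'X_ord_max by rewrite -evalY.
exists A, pi, 'X_ord0; split.
- split=> //; exists f, g; split=> //.
  + by exists (size F).-1; apply: eval_homogenize.
  + by exists ((size G).-1 + e)%N; rewrite /g HHE; apply: eval_homogenize.
  split=> // [q qf0|q [u qgu]].
    have /eqP := congr1 Psi qf0; rewrite rmorphM PhiK rmorph0 mulf_eq0.
    rewrite (negPf (monic_neq0 mFF)) orbF => /eqP q0.
    by rewrite -(PsiK q) q0 rmorph0.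
  have [|z Ez] := @coprimep_coprime_pair K F G e mF mG coFG (Psi q) (Psi u).
    by have := congr1 Psi qgu; rewrite !rmorphM !PhiK.
  by exists (Phi z); rewrite -rmorphM -Ez PsiK.
- move=> i; rewrite -(dim_degree_part mF szF IFF betaP adP rhoC rho_ker).
  rewrite /hilbert_function /graded_component; congr (\dim <<_>>).
  apply/eq_in_map => b; rewrite mem_iota add0n ltnS => /andP[_ le_bi].
  rewrite homogenizeXn // -mul_polyC polyC_exp !rmorphM !rmorphXn.
  by rewrite rhoX rhoY.
- by rewrite dhomogX; apply/eqP/mdeg1.
- rewrite -evalX; apply/eqP => /(congr1 Psi)/eqP.
  by rewrite PhiK rmorph0 polyC_eq0 polyX_eq0.
rewrite /linear_form_jordan_type -rhoX.
apply: (jordan_type_cells mF szF IFF betaP adP rhoC _ rho_ker).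
- exact: coordinate_presentation_surj det0 pi_surj.
- exact: sorted_power_partition (ci_blocks_decreasing blk).
- exact: power_partition_gt0.
Qed.

Theorem theorem2p19 (K : fieldType) (d k : nat)
    (hd : (2 <= d)%N) (hk : (1 <= k)%N)
    (K_infinite : infinite_field K)
    (K_char : char_zero_or_gt K (2 * d + k - 3))
    (t : nat) (p n : nat -> nat)
    (p_decr : forall i, (1 <= i < t)%N -> (p i.+1 < p i)%N)
    (p_gt0 : forall i, (1 <= i <= t)%N -> (0 < p i)%N)
    (n_gt0 : forall i, (1 <= i <= t)%N -> (1 <= n i)%N)
    (P_diag : forall i,
       diagonal_length (power_partition t p n) i = Tseq d k i) :
  (exists (A : falgType K) (pi : {lrmorphism {mpoly K[2]} -> A})
      (l : {mpoly K[2]}),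
     [/\ graded_CI_quotient pi,
         forall i, hilbert_function pi i = Tseq d k i,
         l \is 1.-homog,
         l != 0
       & linear_form_jordan_type pi l (power_partition t p n)]) <->
  (forall i, (2 <= i <= t)%N -> p i.-1 = (n i.-1 + n i + p i)%N).
Proof.
have decr := decreasing_uptoS p_decr.
split=> [[A [pi [l [CI _ hl l0 jt]]]]|blocks].
  apply/(block_relationP decr n_gt0).
  have [t' [p' [n' [blk ->]]]] := ci_jordan_type_blocks CI hl l0 jt.
  have [_ _ n'_gt0 blocks'] := blk.
  exact/(block_relationP (ci_blocks_decreasing blk) n'_gt0).
(* The empty partition has no cell on diagonal 0, whereas [T_0 = 1]. *)
have t_gt0 : (0 < t)%N.
  by case: t P_diag {p_decr p_gt0 n_gt0 decr blocks} => // /(_ 0%N).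
have blk : ci_blocks t p n by [].
have [A [pi [l [CI hilb hl l0 jt]]]] := ci_of_blocks K blk.
by exists A, pi, l; split=> // i; rewrite hilb P_diag.
Qed.
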